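(* Let $H$ be a quasi-Hopf algebra, $A$ a left $H$-module algebra, $B$ an associative algebra, $v:H\to B$ an algebra map and $u:A\to B^v$ a morphism of left $H$-module algebras. Let $R:H_0\otimes A\to A\otimes H_0$, $$R(h\otimes a)=X^1Y^1_1h_1g^1S(q^2Y^2_2)Y^3\cdot a\otimes X^2Y^1_2h_2g^2S(X^3q^1Y^2_1),$$ and let $\mu_{B^v}$ be the multiplication of $B^v$. Then $$\mu_{B^v}\circ(u\otimes v)\circ R=\mu_{B^v}\circ(v\otimes u),$$ that is, the input data for the universal property of $A\# H$ is also an input data for the universal property of the twisted tensor product $A\otimes_RH_0=A\diamond H_0$ in the monoidal category ${}_H\mathcal{M}$ of left $H$-modules. Moreover, if we denote by $u\# v:A\# H\to B$ the algebra map provided by the universal property of $A\# H$ and by $w:A\diamond H_0\to B^v$ the morphism of left $H$-module algebras provided by the universal property of $A\diamond H_0=A\otimes_RH_0$, then $$(u\# v)\circ\Pi=w,$$ where $\Pi:A\diamond H_0\to(A\# H)^j$, $\Pi(a\otimes h)=x^1\cdot a\,\#\,x^2hS(x^3)$, $j(h)=1_A\# h$.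
   Context: Throughout, $k$ is a field, all algebras and linear spaces are over $k$, $\otimes=\otimes_k$. A quasi-bialgebra $(H,\Delta,\varepsilon,\Phi)$ is a unital associative algebra $H$ with algebra maps $\Delta:H\to H\otimes H$, $\varepsilon:H\to k$ and an invertible $\Phi\in H^{\otimes 3}$ such that for all $h\in H$: $(id\otimes\Delta)(\Delta(h))=\Phi(\Delta\otimes id)(\Delta(h))\Phi^{-1}$; $(id\otimes\varepsilon)(\Delta(h))=h=(\varepsilon\otimes id)(\Delta(h))$; $(1\otimes\Phi)(id\otimes\Delta\otimes id)(\Phi)(\Phi\otimes 1)=(id\otimes id\otimes\Delta)(\Phi)(\Delta\otimes id\otimes id)(\Phi)$; $(\varepsilon\otimes id\otimes id)(\Phi)=(id\otimes\varepsilon\otimes id)(\Phi)=(id\otimes id\otimes\varepsilon)(\Phi)=1\otimes 1$. Notation (summation understood): $\Delta(h)=h_1\otimes h_2$; $\Phi=X^1\otimes X^2\otimes X^3=Y^1\otimes Y^2\otimes Y^3=\cdots$ and $\Phi^{-1}=x^1\otimes x^2\otimes x^3=y^1\otimes y^2\otimes y^3=\cdots$ (different letters denote independent copies); lower indices denote components of $\Delta$, e.g. $\Delta(X^3)=X^3_1\otimes X^3_2$. A quasi-Hopf algebra is a quasi-bialgebra $H$ with an algebra anti-automorphism $S$ and $\alpha,\beta\in H$ such that $S(h_1)\alpha h_2=\varepsilon(h)\alpha$, $h_1\beta S(h_2)=\varepsilon(h)\beta$ for all $h$, $X^1\beta S(X^2)\alpha X^3=1$, $S(x^1)\alpha x^2\beta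 S(x^3)=1$; normalised (as one may) so that $\varepsilon(\alpha)=\varepsilon(\beta)=1$ and $\varepsilon\circ S=\varepsilon$. Drinfeld twist: let $A^1\otimes A^2\otimes A^3\otimes A^4=(\Phi\otimes 1)(\Delta\otimes id\otimes id)(\Phi^{-1})$, $B^1\otimes B^2\otimes B^3\otimes B^4=(\Delta\otimes id\otimes id)(\Phi)(\Phi^{-1}\otimes 1)$, $\gamma=S(A^2)\alpha A^3\otimes S(A^1)\alpha A^4$, $\delta=B^1\beta S(B^4)\otimes B^2\beta S(B^3)$, $\Delta^{cop}(h)=h_2\otimes h_1$. Then $f=(S\otimes S)(\Delta^{cop}(x^1))\,\gamma\,\Delta(x^2\beta S(x^3))$ is invertible with inverse $f^{-1}=g^1\otimes g^2=\Delta(S(x^1)\alpha x^2)\,\delta\,(S\otimes S)(\Delta^{cop}(x^3))$. Also $q_R=q^1\otimes q^2=X^1\otimes S^{-1}(\alpha X^3)X^2$. A left $H$-module algebra is a left $H$-module $A$ with a multiplication and (usual) unit $1_A$ such that $(aa')a''=(X^1\cdot a)[(X^2\cdot a')(X^3\cdot a'')]$, $h\cdot(aa')=(h_1\cdot a)(h_2\cdot a')$, $h\cdot 1_A=\varepsilon(h)1_A$. Morphisms are $H$-linear, multiplicative, unital maps. The smash product $A\# H$ is $A\otimes H$ with the associative multiplication $(a\# h)(a'\# h')=(x^1\cdot a)(x^2h_1\cdot a')\# x^3h_2h'$ and unit $1_A\# 1$. If $B$ is an associative algebra and $v:H\to B$ an algebra map, $B^v$ is the left $H$-module algebra with underlying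 space $B$, multiplication $\mu_{B^v}(b\otimes b')=v(X^1)bv(S(x^1X^2)\alpha x^2X^3_1)b'v(S(x^3X^3_2))$, unit $v(\beta)$, action $h\triangleright_v b=v(h_1)bv(S(h_2))$. $H_0:=H^{id_H}$ (multiplication $*$, action $h\triangleright h'=h_1h'S(h_2)$). The algebra map $v:H\to B$ is also a morphism of left $H$-module algebras $H_0\to B^v$. Universal property of $A\# H$ (known): with $i_0:A\to(A\# H)^j$, $i_0(a)=x^1\cdot a\# x^2\beta S(x^3)$, for $B,v,u$ as in the claim there is a unique algebra map $u\# v:A\# H\to B$ with $(u\# v)\circ i_0=u$, $(u\# v)\circ j=v$; explicitly $(u\# v)(a\# h)=v(X^1)u(a)v(S(X^2)\alpha X^3h)$. $A\diamond H_0=A\otimes_RH_0$ is the twisted tensor product in ${}_H\mathcal{M}$ afforded by the twisting map $R$: writing $R(h\otimes a)=h_{(-1)}\cdot a\otimes h_{(0)}$, it is $A\otimes H_0$ with unit $1_A\otimes\beta$, action $h\cdot(a\otimes h')=h_1\cdot a\otimes h_2\triangleright h'$ and multiplication $(a\otimes h)(a'\otimes h')=(y^1X^1\cdot a)(y^2Y^1(x^1X^2\triangleright h)_{(-1)}x^2X^3_1\cdot a')\otimes(y^3_1Y^2\triangleright(x^1X^2\triangleright h)_{(0)})*(y^3_2Y^3x^3X^3_2\triangleright h')$. Universal property (known): if $X$ is a left $H$-module algebra and $u':A\to X$, $v':H_0\to X$ are morphisms of left $H$-module algebras with $\mu_X\circ(u'\otimes v')\circ R=\mu_X\circ(v'\otimes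 u')$, there is a unique morphism of left $H$-module algebras $w:A\otimes_RH_0\to X$ with $w(a\otimes\beta)=u'(a)$, $w(1_A\otimes h)=v'(h)$; explicitly $w=\mu_X\circ(u'\otimes v')$. *)

(* Defs.v *)
From HB Require Import structures.
From mathcomp Require Import all_boot all_algebra.
From mathcomp Require Import generic_quotient sesquilinear boolp.

Set Implicit Arguments.
Unset Strict Implicit.
Unset Printing Implicit Defensive.

Import GRing.Theory.
Local Open Scope ring_scope.
Local Open Scope quotient_scope.

(* Unital associative algebras over k.  MathComp's algType also requires      *)
(* 1 != 0, which would exclude the zero algebra as a target of algebra maps.  *)
(* Every assocAlgType is a pzRingType, hence *%R, 1 and their theory apply.   *)
HB.mixin Record Lmodule_isAssocAlgebra (k : fieldType) A
    of GRing.Lmodule k A := {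
  assoc_mul : A -> A -> A;
  assoc_one : A;
  assoc_mulA : associative assoc_mul;
  assoc_mul1 : left_id assoc_one assoc_mul;
  assoc_mulr1 : right_id assoc_one assoc_mul;
  assoc_mulDl : left_distributive assoc_mul +%R;
  assoc_mulDr : right_distributive assoc_mul +%R;
  assoc_mulZl : forall (c : k) x y, c *: assoc_mul x y = assoc_mul (c *: x) y;
  assoc_mulZr : forall (c : k) x y, c *: assoc_mul x y = assoc_mul x (c *: y)
}.

#[short(type="assocAlgType")]
HB.structure Definition AssocAlgebra (k : fieldType) :=
  {A of GRing.Lmodule k A & Lmodule_isAssocAlgebra k A}.

Section AssocAlgebraRing.
Variables (k : fieldType) (A : assocAlgType k).
HB.instance Definition _ := GRing.Zmodule_isPzRing.Build (AssocAlgebra.sort A)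
  (@assoc_mulA k A) (@assoc_mul1 k A) (@assoc_mulr1 k A)
  (@assoc_mulDl k A) (@assoc_mulDr k A).
Lemma alg_scalerAl (c : k) (x y : A) : c *: (x * y) = (c *: x) * y.
Proof. exact: assoc_mulZl. Qed.
Lemma alg_scalerAr (c : k) (x y : A) : c *: (x * y) = x * (c *: y).
Proof. exact: assoc_mulZr. Qed.
End AssocAlgebraRing.

Definition algebra_map (k : fieldType) (A B : assocAlgType k) (f : A -> B) :
    Prop :=
  [/\ linear f, {morph f : x y / x * y} & f 1 = 1].

(* The tensor product of U and V: formal sums of pairs (u, v), where two sums *)
(* are identified when no bilinear map on U x V separates them.               *)
Section TensorProduct.
Variables (k : fieldType) (U V : lmodType k).

Definition bilin_sum (W : zmodType) (F : U -> V -> W) (s : seq (U * V)) : W :=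
  \sum_(p <- s) F p.1 p.2.

Definition tensor_equiv (s t : seq (U * V)) : bool :=
  `[< forall (W : lmodType k) (F : {bilinear U -> V -> W}),
        bilin_sum F s = bilin_sum F t >].

Lemma tensor_equiv_refl : reflexive tensor_equiv.
Proof. by move=> s; apply/asboolP. Qed.

Lemma tensor_equiv_sym : symmetric tensor_equiv.
Proof. by move=> s t; apply/asboolP/asboolP => h W F; rewrite h. Qed.

Lemma tensor_equiv_trans : transitive tensor_equiv.
Proof.
by move=> t s r /asboolP h /asboolP h'; apply/asboolP => W F; rewrite h h'.
Qed.

Canonical tensor_equivRel :=
  EquivRel tensor_equiv tensor_equiv_refl tensor_equiv_sym tensor_equiv_trans.

Definition tensor : Type := {eq_quot tensor_equivRel}.
HB.instance Definition _ := Choice.on tensor.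
HB.instance Definition _ := EqQuotient.on tensor.

Definition tmk (s : seq (U * V)) : tensor := \pi_tensor s.

Definition pure_tensor (u : U) (v : V) : tensor := tmk [:: (u, v)].

(* Sweedler-type summation: tsum t F is \sum_i F x_i y_i, for a chosen        *)
(* representation t = \sum_i x_i (x) y_i.  When F is bilinear the result does *)
(* not depend on this choice (tsum_mk).                                       *)
Definition tsum (W : zmodType) (t : tensor) (F : U -> V -> W) : W :=
  bilin_sum F (repr t).

Lemma tmk_eq (s t : seq (U * V)) :
  tmk s = tmk t <->
  forall (W : lmodType k) (F : {bilinear U -> V -> W}),
    bilin_sum F s = bilin_sum F t.
Proof.
split=> [/eqquotP /asboolP //| h].
by apply/eqquotP/asboolP.
Qed.

Lemma tmk_repr (t : tensor) : tmk (repr t) = t.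
Proof. exact: reprK. Qed.

Lemma tsum_mk (W : lmodType k) (F : {bilinear U -> V -> W}) s :
  tsum (tmk s) F = bilin_sum F s.
Proof. by have /tmk_eq := tmk_repr (tmk s); apply. Qed.

Lemma tensorP (s t : tensor) :
  (forall (W : lmodType k) (F : {bilinear U -> V -> W}), tsum s F = tsum t F) ->
  s = t.
Proof. by move=> h; rewrite -(tmk_repr s) -(tmk_repr t); apply: (tmk_eq _ _).2. Qed.

Definition tensor_zero : tensor := tmk [::].
Definition tensor_opp (t : tensor) : tensor :=
  tmk [seq (- p.1, p.2) | p <- repr t].
Definition tensor_add (s t : tensor) : tensor := tmk (repr s ++ repr t).
Definition tensor_scale (c : k) (t : tensor) : tensor :=
  tmk [seq (c *: p.1, p.2) | p <- repr t].

Section TsumOps.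
Variables (W : lmodType k) (F : {bilinear U -> V -> W}).

Lemma tsum_zero : tsum tensor_zero F = 0.
Proof. by rewrite tsum_mk /bilin_sum big_nil. Qed.

Lemma tsum_add s t : tsum (tensor_add s t) F = tsum s F + tsum t F.
Proof. by rewrite tsum_mk /bilin_sum big_cat. Qed.

Lemma tsum_opp t : tsum (tensor_opp t) F = - tsum t F.
Proof.
rewrite tsum_mk /bilin_sum big_map -sumrN.
by apply: eq_bigr => p _; rewrite linearNl.
Qed.

Lemma tsum_scale c t : tsum (tensor_scale c t) F = c *: tsum t F.
Proof.
rewrite tsum_mk /bilin_sum big_map /tsum /bilin_sum scaler_sumr.
by apply: eq_bigr => p _; rewrite linearZl_LR.
Qed.

End TsumOps.

Lemma tensor_addA : associative tensor_add.
Proof. by move=> r s t; apply: tensorP => W F; rewrite !tsum_add addrA. Qed.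
Lemma tensor_addC : commutative tensor_add.
Proof. by move=> s t; apply: tensorP => W F; rewrite !tsum_add addrC. Qed.
Lemma tensor_add0 : left_id tensor_zero tensor_add.
Proof. by move=> t; apply: tensorP => W F; rewrite tsum_add tsum_zero add0r. Qed.
Lemma tensor_addN : left_inverse tensor_zero tensor_opp tensor_add.
Proof.
by move=> t; apply: tensorP => W F; rewrite tsum_add tsum_opp tsum_zero addNr.
Qed.
HB.instance Definition _ := GRing.isZmodule.Build tensor
  tensor_addA tensor_addC tensor_add0 tensor_addN.

Lemma tensor_scaleA a b t :
  tensor_scale a (tensor_scale b t) = tensor_scale (a * b) t.
Proof. by apply: tensorP => W F; rewrite !tsum_scale scalerA. Qed.
Lemma tensor_scale1 : left_id 1 tensor_scale.
Proof. by move=> t; apply: tensorP => W F; rewrite tsum_scale scale1r. Qed.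
Lemma tensor_scaleDr : right_distributive tensor_scale +%R.
Proof.
by move=> c s t; apply: tensorP => W F; rewrite !(tsum_scale, tsum_add) scalerDr.
Qed.
Lemma tensor_scaleDl t : {morph tensor_scale^~ t : a b / a + b}.
Proof.
by move=> a b; apply: tensorP => W F; rewrite !(tsum_scale, tsum_add) scalerDl.
Qed.
HB.instance Definition _ := GRing.Zmodule_isLmodule.Build k tensor
  tensor_scaleA tensor_scale1 tensor_scaleDr tensor_scaleDl.

Lemma tsum_bilinear_linear (W : lmodType k) (F : {bilinear U -> V -> W}) :
  linear (fun t => tsum t F).
Proof. by move=> c s t; rewrite tsum_add tsum_scale. Qed.

Lemma tsum_linear (W : lmodType k) (F : U -> V -> W) :
  bilinear_for *:%R *:%R F -> linear (fun t => tsum t F).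
Proof.
move=> FP; pose M := bilinear_isBilinear.Build _ _ _ _ _ _ F FP.
pose G : {bilinear U -> V -> W} := HB.pack F M.
exact: (@tsum_bilinear_linear _ G).
Qed.

Lemma tsum_pure (W : lmodType k) (F : U -> V -> W) u v :
  bilinear_for *:%R *:%R F -> tsum (pure_tensor u v) F = F u v.
Proof.
move=> FP; pose M := bilinear_isBilinear.Build _ _ _ _ _ _ F FP.
pose G : {bilinear U -> V -> W} := HB.pack F M.
by rewrite (@tsum_mk _ G) /bilin_sum big_seq1.
Qed.

Lemma pure_tensor_bilinear : bilinear_for *:%R *:%R pure_tensor.
Proof.
split=> [v | u] c x y; apply: tensorP => W F.
  rewrite tsum_bilinear_linear !tsum_mk /bilin_sum !big_seq1 /=.
  by rewrite linearDl linearZl_LR.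
rewrite tsum_bilinear_linear !tsum_mk /bilin_sum !big_seq1 /=.
by rewrite linearP.
Qed.

Lemma pure_tensorDl u u' v :
  pure_tensor (u + u') v = pure_tensor u v + pure_tensor u' v.
Proof. by have := pure_tensor_bilinear.1 v 1 u u'; rewrite /= !scale1r. Qed.

Lemma pure_tensorDr u v v' :
  pure_tensor u (v + v') = pure_tensor u v + pure_tensor u v'.
Proof. by have := pure_tensor_bilinear.2 u 1 v v'; rewrite /= !scale1r. Qed.

Lemma pure_tensor0l v : pure_tensor 0 v = 0.
Proof. by apply: (addrI (pure_tensor 0 v)); rewrite -pure_tensorDl !addr0. Qed.

Lemma pure_tensor0r u : pure_tensor u 0 = 0.
Proof. by apply: (addrI (pure_tensor u 0)); rewrite -pure_tensorDr !addr0. Qed.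

Lemma pure_tensorZl c u v : pure_tensor (c *: u) v = c *: pure_tensor u v.
Proof.
have := pure_tensor_bilinear.1 v c u 0.
by rewrite /= pure_tensor0l !addr0.
Qed.

Lemma pure_tensorZr c u v : pure_tensor u (c *: v) = c *: pure_tensor u v.
Proof.
have := pure_tensor_bilinear.2 u c v 0.
by rewrite /= pure_tensor0r !addr0.
Qed.

Lemma tensor_sum_pure (t : tensor) : t = tsum t pure_tensor.
Proof.
apply: tensorP => W F; rewrite {1}/tsum {2}/tsum /bilin_sum.
have D0 : tsum 0 F = 0 by exact: tsum_zero.
rewrite (big_morph (fun t => tsum t F) (tsum_add F) D0).
by apply: eq_bigr => p _; rewrite tsum_mk /bilin_sum big_seq1.
Qed.

Lemma tensor_lin_ext (W : lmodType k) (f g : tensor -> W) :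
  linear f -> linear g ->
  (forall u v, f (pure_tensor u v) = g (pure_tensor u v)) -> f =1 g.
Proof.
move=> lf lg fg t; rewrite (tensor_sum_pure t) /tsum /bilin_sum.
pose F : {linear tensor -> W} := HB.pack f (GRing.isLinear.Build _ _ _ _ f lf).
pose G : {linear tensor -> W} := HB.pack g (GRing.isLinear.Build _ _ _ _ g lg).
rewrite -[LHS]/(F _) -[RHS]/(G _) !linear_sum.
by apply: eq_bigr => p _; exact: fg.
Qed.

End TensorProduct.

Arguments tensor_sum_pure {k U V}.
Arguments tensor {k} (U V)%_type_scope.
Arguments tsum {k U V W} t F.
Arguments pure_tensor {k U V} & u v.

Notation "U ⊗ V" := (tensor U V) (at level 44, left associativity) : type_scope.
Notation "u ⊗ v" := (pure_tensor u v)
  (at level 44, left associativity) : ring_scope.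

Notation "\sw_ ( x , y <- t ) E" := (tsum t (fun x y => E))
  (at level 41, x name, y name, E at level 49,
   format "'[' \sw_ ( x ,  y  <-  t ) '/  '  E ']'") : ring_scope.
Notation "\sw_ ( x , y , z <- t ) E" :=
  (tsum t (fun s z => tsum s (fun x y => E)))
  (at level 41, x name, y name, z name, E at level 49,
   format "'[' \sw_ ( x ,  y ,  z  <-  t ) '/  '  E ']'") : ring_scope.
Notation "\sw_ ( x , y , z , w <- t ) E" :=
  (tsum t (fun r w => tsum r (fun s z => tsum s (fun x y => E))))
  (at level 41, x name, y name, z name, w name, E at level 49,
   format "'[' \sw_ ( x ,  y ,  z ,  w  <-  t ) '/  '  E ']'") : ring_scope.

Section TensorAlgebra.
Variables (k : fieldType) (A B : assocAlgType k).

Definition tensor_one : A ⊗ B := (1 : A) ⊗ (1 : B).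
Definition tensor_mul (s t : A ⊗ B) : A ⊗ B :=
  \sw_(a, b <- s) \sw_(c, d <- t) (a * c) ⊗ (b * d).

Let inner_bilinear a b :
  bilinear_for *:%R *:%R (fun (c : A) (d : B) => (a * c) ⊗ (b * d)).
Proof.
split=> [d | d] e x y /=; first by rewrite mulrDr -alg_scalerAr pure_tensorDl pure_tensorZl.
by rewrite mulrDr -alg_scalerAr pure_tensorDr pure_tensorZr.
Qed.

Lemma tensor_mul_linearr s : linear (tensor_mul s).
Proof.
move=> e x y; rewrite /tensor_mul {1 2 3}/tsum /bilin_sum.
rewrite scaler_sumr -big_split; apply: eq_bigr => p _ /=.
exact: tsum_linear (inner_bilinear _ _) e x y.
Qed.

Let outer_bilinear t :
  bilinear_for *:%R *:%R
    (fun (a : A) (b : B) => \sw_(c, d <- t) (a * c) ⊗ (b * d)).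
Proof.
split=> [b | a] e x y; rewrite /= /tsum /bilin_sum scaler_sumr -big_split;
  apply: eq_bigr => p _ /=.
  by rewrite mulrDl -alg_scalerAl pure_tensorDl pure_tensorZl.
by rewrite mulrDl -alg_scalerAl pure_tensorDr pure_tensorZr.
Qed.

Lemma tensor_mul_linearl t : linear (tensor_mul^~ t).
Proof. exact: tsum_linear (outer_bilinear t). Qed.

Lemma tensor_mul_pure a b c d :
  tensor_mul (a ⊗ b) (c ⊗ d) = (a * c) ⊗ (b * d).
Proof.
rewrite /tensor_mul tsum_pure; last exact: outer_bilinear.
by rewrite tsum_pure //; exact: inner_bilinear.
Qed.

Let MDl : left_distributive tensor_mul +%R.
Proof.
by move=> x y t; have := tensor_mul_linearl t 1 x y; rewrite /= !scale1r.
Qed.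
Let MDr : right_distributive tensor_mul +%R.
Proof.
by move=> t x y; have := tensor_mul_linearr t 1 x y; rewrite /= !scale1r.
Qed.
Let MZr c s t : c *: tensor_mul s t = tensor_mul s (c *: t).
Proof.
have M0 : tensor_mul s 0 = 0.
  by apply: (addrI (tensor_mul s 0)); rewrite -MDr !addr0.
by have := tensor_mul_linearr s c t 0; rewrite /= M0 !addr0.
Qed.
Let MZl c s t : c *: tensor_mul s t = tensor_mul (c *: s) t.
Proof.
have M0 : tensor_mul 0 t = 0.
  by apply: (addrI (tensor_mul 0 t)); rewrite -MDl !addr0.
by have := tensor_mul_linearl t c s 0; rewrite /= M0 !addr0.
Qed.

Lemma tensor_mulA : associative tensor_mul.
Proof.
move=> r s t.
pose f1 r := tensor_mul r (tensor_mul s t).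
apply: (tensor_lin_ext (f := f1)
  (g := fun r => tensor_mul (tensor_mul r s) t)) => [||a b].
- exact: tensor_mul_linearl.
- by move=> c x y; rewrite tensor_mul_linearl tensor_mul_linearl.
rewrite /f1; apply: (tensor_lin_ext
  (f := fun s => tensor_mul (a ⊗ b) (tensor_mul s t))
  (g := fun s => tensor_mul (tensor_mul (a ⊗ b) s) t)) => [||a' b'].
- by move=> c x y; rewrite tensor_mul_linearl tensor_mul_linearr.
- by move=> c x y; rewrite tensor_mul_linearr tensor_mul_linearl.
apply: (tensor_lin_ext
  (f := fun t => tensor_mul (a ⊗ b) (tensor_mul (a' ⊗ b') t))
  (g := tensor_mul (tensor_mul (a ⊗ b) (a' ⊗ b')))) => [||a'' b''].
- by move=> c x y; rewrite !tensor_mul_linearr.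
- exact: tensor_mul_linearr.
by rewrite !tensor_mul_pure !mulrA.
Qed.

Lemma tensor_mul1 : left_id tensor_one tensor_mul.
Proof.
apply: (tensor_lin_ext (f := tensor_mul tensor_one) (g := id)) => [||a b] //.
- exact: tensor_mul_linearr.
by rewrite tensor_mul_pure !mul1r.
Qed.
Lemma tensor_mulr1 : right_id tensor_one tensor_mul.
Proof.
apply: (tensor_lin_ext (f := tensor_mul^~ tensor_one) (g := id)) => [||a b] //.
- exact: tensor_mul_linearl.
by rewrite tensor_mul_pure !mulr1.
Qed.

HB.instance Definition _ := Lmodule_isAssocAlgebra.Build k (tensor A B)
  tensor_mulA tensor_mul1 tensor_mulr1 MDl MDr MZl MZr.
HB.instance Definition _ := GRing.Zmodule_isPzRing.Build (tensor A B)
  tensor_mulA tensor_mul1 tensor_mulr1 MDl MDr.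

End TensorAlgebra.

Section TensorMap.
Variables (k : fieldType) (U U' V V' : lmodType k).
Definition tmap (f : U -> U') (g : V -> V') (t : U ⊗ V) : U' ⊗ V' :=
  \sw_(x, y <- t) f x ⊗ g y.
End TensorMap.

Record quasiBialgebra (k : fieldType) := QuasiBialgebra {
  qb_alg :> assocAlgType k;
  comul : qb_alg -> qb_alg ⊗ qb_alg;
  counit : qb_alg -> k;
  reassoc : qb_alg ⊗ qb_alg ⊗ qb_alg;
  reassoc_inv : qb_alg ⊗ qb_alg ⊗ qb_alg;
  comul_algebra_map : algebra_map comul;
  counit_algebra_map :
    [/\ scalar counit, {morph counit : x y / x * y} & counit 1 = 1];
  reassoc_mulV : reassoc * reassoc_inv = 1;
  reassoc_mulVl : reassoc_inv * reassoc = 1;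
  comul_quasi_coassoc : forall h : qb_alg,
    \sw_(h1, h2 <- comul h) \sw_(h21, h22 <- comul h2) h1 ⊗ h21 ⊗ h22
    = reassoc * (\sw_(h1, h2 <- comul h) comul h1 ⊗ h2) * reassoc_inv;
  comul_counitr : forall h : qb_alg,
    \sw_(h1, h2 <- comul h) counit h2 *: h1 = h;
  comul_counitl : forall h : qb_alg,
    \sw_(h1, h2 <- comul h) counit h1 *: h2 = h;
  reassoc_pentagon :
    (\sw_(X1, X2, X3 <- reassoc) (1 : qb_alg) ⊗ X1 ⊗ X2 ⊗ X3)
    * (\sw_(X1, X2, X3 <- reassoc) \sw_(X21, X22 <- comul X2)
         X1 ⊗ X21 ⊗ X22 ⊗ X3)
    * (reassoc ⊗ (1 : qb_alg))
    = (\sw_(X1, X2, X3 <- reassoc) \sw_(X31, X32 <- comul X3)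
         X1 ⊗ X2 ⊗ X31 ⊗ X32)
      * (\sw_(X1, X2, X3 <- reassoc) comul X1 ⊗ X2 ⊗ X3);
  reassoc_counit1 : \sw_(X1, X2, X3 <- reassoc) counit X1 *: (X2 ⊗ X3) = 1 ⊗ 1;
  reassoc_counit2 : \sw_(X1, X2, X3 <- reassoc) counit X2 *: (X1 ⊗ X3) = 1 ⊗ 1;
  reassoc_counit3 : \sw_(X1, X2, X3 <- reassoc) counit X3 *: (X1 ⊗ X2) = 1 ⊗ 1
}.
Arguments comul {k q} h : rename.
Arguments counit {k q} h : rename.
Arguments reassoc {k q}.
Arguments reassoc_inv {k q}.

Record quasiHopf (k : fieldType) := QuasiHopf {
  qh_quasiBialgebra :> quasiBialgebra k;
  antipode : qh_quasiBialgebra -> qh_quasiBialgebra;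
  antipode_inv : qh_quasiBialgebra -> qh_quasiBialgebra;
  alpha : qh_quasiBialgebra;
  beta : qh_quasiBialgebra;
  antipode_linear : linear antipode;
  antipodeM : forall x y, antipode (x * y) = antipode y * antipode x;
  antipode1 : antipode 1 = 1;
  antipodeK : cancel antipode antipode_inv;
  antipode_invK : cancel antipode_inv antipode;
  antipode_alpha : forall h : qh_quasiBialgebra,
    \sw_(h1, h2 <- comul h) antipode h1 * alpha * h2 = counit h *: alpha;
  antipode_beta : forall h : qh_quasiBialgebra,
    \sw_(h1, h2 <- comul h) h1 * beta * antipode h2 = counit h *: beta;
  antipode_assoc :
    \sw_(X1, X2, X3 <- reassoc) X1 * beta * antipode X2 * alpha * X3 = 1;
  antipode_assoc_inv :
    \sw_(x1, x2, x3 <- reassoc_inv)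
       antipode x1 * alpha * x2 * beta * antipode x3 = 1;
  counit_alpha : counit alpha = 1;
  counit_beta : counit beta = 1;
  counit_antipode : forall h, counit (antipode h) = counit h
}.
Arguments antipode {k q} h : rename.
Arguments antipode_inv {k q} h : rename.
Arguments alpha {k q}.
Arguments beta {k q}.

Section DrinfeldTwist.
Variables (k : fieldType) (H : quasiHopf k).
Local Notation Φ := (@reassoc k H).
Local Notation Φ' := (@reassoc_inv k H).
Local Notation S := (@antipode k H).
Local Notation α := (@alpha k H).
Local Notation β := (@beta k H).

(* (S (x) S) o Delta^cop *)
Definition antipode_cop (h : H) : H ⊗ H :=
  \sw_(h1, h2 <- comul h) S h2 ⊗ S h1.

Definition twist_gamma : H ⊗ H :=
  \sw_(A1, A2, A3, A4 <-
         (Φ ⊗ (1 : H)) * (\sw_(x1, x2, x3 <- Φ') comul x1 ⊗ x2 ⊗ x3))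
    (S A2 * α * A3) ⊗ (S A1 * α * A4).

Definition twist_delta : H ⊗ H :=
  \sw_(B1, B2, B3, B4 <-
         (\sw_(X1, X2, X3 <- Φ) comul X1 ⊗ X2 ⊗ X3) * (Φ' ⊗ (1 : H)))
    (B1 * β * S B4) ⊗ (B2 * β * S B3).

Definition drinfeld_twist : H ⊗ H :=
  \sw_(x1, x2, x3 <- Φ')
    antipode_cop x1 * twist_gamma * comul (x2 * β * S x3).

(* The explicit formula for the inverse of drinfeld_twist. *)
Definition drinfeld_twist_inv : H ⊗ H :=
  \sw_(x1, x2, x3 <- Φ')
    comul (S x1 * α * x2) * twist_delta * antipode_cop x3.

Definition qR : H ⊗ H :=
  \sw_(X1, X2, X3 <- Φ) X1 ⊗ (antipode_inv (α * X3) * X2).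

End DrinfeldTwist.
Arguments drinfeld_twist_inv {k H}.
Arguments qR {k H}.

(* The operations of a left H-module algebra.  They are separated from the    *)
(* axioms because morphisms only refer to the operations; this lets B^v, H_0  *)
(* and the twisted tensor product be used below without first establishing    *)
(* (known) facts such as quasi-associativity of their multiplication.         *)
Record modAlgOps (k : fieldType) (H : quasiBialgebra k) := ModAlgOps {
  ma_space :> lmodType k;
  ma_act : H -> ma_space -> ma_space;
  ma_mul : ma_space -> ma_space -> ma_space;
  ma_one : ma_space
}.
Arguments ma_act {k H m} h a : rename.
Arguments ma_mul {k H m} a b : rename.
Arguments ma_one {k H} m : rename.

Notation "h ▷ a" := (ma_act h a) (at level 42, right associativity) : ring_scope.
Notation "a ⋆ b" := (ma_mul a b) (at level 43, left associativity) : ring_scope.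

Record moduleAlgebra (k : fieldType) (H : quasiBialgebra k) := ModuleAlgebra {
  ma_ops :> modAlgOps H;
  ma_act_bilinear : bilinear_for *:%R *:%R (@ma_act k H ma_ops);
  ma_act1 : forall a : ma_ops, 1 ▷ a = a;
  ma_actM : forall (h h' : H) (a : ma_ops), (h * h') ▷ a = h ▷ (h' ▷ a);
  ma_mul_bilinear : bilinear_for *:%R *:%R (@ma_mul k H ma_ops);
  ma_mul1 : left_id (ma_one ma_ops) ma_mul;
  ma_mulr1 : right_id (ma_one ma_ops) ma_mul;
  ma_mul_quasi_assoc : forall a b c : ma_ops,
    (a ⋆ b) ⋆ c
    = \sw_(X1, X2, X3 <- reassoc) (X1 ▷ a) ⋆ ((X2 ▷ b) ⋆ (X3 ▷ c));
  ma_act_mul : forall (h : H) (a b : ma_ops),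
    h ▷ (a ⋆ b) = \sw_(h1, h2 <- comul h) (h1 ▷ a) ⋆ (h2 ▷ b);
  ma_act_one : forall h : H, h ▷ ma_one ma_ops = counit h *: ma_one ma_ops
}.

Definition module_algebra_morphism (k : fieldType) (H : quasiBialgebra k)
    (A A' : modAlgOps H) (f : A -> A') : Prop :=
  [/\ linear f,
      forall (h : H) (a : A), f (h ▷ a) = h ▷ f a,
      forall a b : A, f (a ⋆ b) = f a ⋆ f b
    & f (ma_one A) = ma_one A'].

Definition ma_mult (k : fieldType) (H : quasiBialgebra k) (A : modAlgOps H)
    (t : A ⊗ A) : A :=
  \sw_(a, b <- t) a ⋆ b.

Section TwistedTensorProduct.
Variables (k : fieldType) (H : quasiBialgebra k) (A D : modAlgOps H).
Variable R : D ⊗ A -> A ⊗ D.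
Local Notation Φ := (@reassoc k H).
Local Notation Φ' := (@reassoc_inv k H).

Definition twisted_act (h : H) (t : A ⊗ D) : A ⊗ D :=
  \sw_(a, d <- t) \sw_(h1, h2 <- comul h) (h1 ▷ a) ⊗ (h2 ▷ d).

Definition twisted_mul (s t : A ⊗ D) : A ⊗ D :=
  \sw_(a, d <- s) \sw_(a', d' <- t)
  \sw_(y1, y2, y3 <- Φ') \sw_(X1, X2, X3 <- Φ)
  \sw_(x1, x2, x3 <- Φ') \sw_(Y1, Y2, Y3 <- Φ)
  \sw_(X31, X32 <- comul X3) \sw_(y31, y32 <- comul y3)
  \sw_(r, r' <- R ((x1 * X2 ▷ d) ⊗ (x2 * X31 ▷ a')))
    ((y1 * X1 ▷ a) ⋆ (y2 * Y1 ▷ r))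
    ⊗ ((y31 * Y2 ▷ r') ⋆ (y32 * Y3 * x3 * X32 ▷ d')).

Definition twisted_tensor : modAlgOps H :=
  @ModAlgOps k H (tensor A D) twisted_act twisted_mul (ma_one A ⊗ ma_one D).

(* The data (u', v') to which the universal property of the twisted tensor    *)
(* product applies, and the maps it characterises.                            *)
Definition twisted_tensor_input (X : modAlgOps H) (u' : A -> X) (v' : D -> X) :=
  [/\ module_algebra_morphism u',
      module_algebra_morphism v'
    & forall t : D ⊗ A,
        ma_mult (tmap u' v' (R t)) = ma_mult (tmap v' u' t)].

Definition twisted_tensor_extension (X : modAlgOps H)
    (u' : A -> X) (v' : D -> X) (w : twisted_tensor -> X) :=
  [/\ module_algebra_morphism w,
      forall a : A, w (a ⊗ ma_one D) = u' a
    & forall d : D, w (ma_one A ⊗ d) = v' d].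

End TwistedTensorProduct.

Section SmashProduct.
Variables (k : fieldType) (H : quasiHopf k).
Local Notation Φ := (@reassoc k H).
Local Notation Φ' := (@reassoc_inv k H).
Local Notation S := (@antipode k H).
Local Notation α := (@alpha k H).
Local Notation β := (@beta k H).

Section TwistedAlgebra.
Variables (B : assocAlgType k) (v : H -> B).

Definition alg_act (h : H) (b : B) : B :=
  \sw_(h1, h2 <- comul h) v h1 * b * v (S h2).

Definition alg_mul (b b' : B) : B :=
  \sw_(X1, X2, X3 <- Φ) \sw_(x1, x2, x3 <- Φ') \sw_(X31, X32 <- comul X3)
    v X1 * b * v (S (x1 * X2) * α * x2 * X31) * b' * v (S (x3 * X32)).

(* The left H-module algebra usually written B^v. *)
Definition alg_ma : modAlgOps H := @ModAlgOps k H B alg_act alg_mul (v β).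

End TwistedAlgebra.

Definition H0 : modAlgOps H := @alg_ma H idfun.

Variable A : modAlgOps H.

(* Multiplication and unit of A # H, whose underlying space is A (x) H. *)
Definition smash_mul (s t : A ⊗ H) : A ⊗ H :=
  \sw_(a, h <- s) \sw_(a', h' <- t)
  \sw_(x1, x2, x3 <- Φ') \sw_(h1, h2 <- comul h)
    ((x1 ▷ a) ⋆ (x2 * h1 ▷ a')) ⊗ (x3 * h2 * h').

Definition smash_one : A ⊗ H := ma_one A ⊗ 1.

Definition smash_j (h : H) : A ⊗ H := ma_one A ⊗ h.

Definition smash_i0 (a : A) : A ⊗ H :=
  \sw_(x1, x2, x3 <- Φ') (x1 ▷ a) ⊗ (x2 * β * S x3).

(* The algebra maps A # H -> B characterised by the universal property. *)
Definition smash_extension (B : assocAlgType k) (v : H -> B) (u : A -> B)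
    (uv : A ⊗ H -> B) :=
  [/\ [/\ linear uv,
          forall s t, uv (smash_mul s t) = uv s * uv t
        & uv smash_one = 1],
      forall a : A, uv (smash_i0 a) = u a
    & forall h : H, uv (smash_j h) = v h].

Definition R_diamond (t : H0 ⊗ A) : A ⊗ H0 :=
  \sw_(h, a <- t)
  \sw_(X1, X2, X3 <- Φ) \sw_(Y1, Y2, Y3 <- Φ)
  \sw_(Y11, Y12 <- comul Y1) \sw_(Y21, Y22 <- comul Y2)
  \sw_(h1, h2 <- comul (h : H))
  \sw_(g1, g2 <- drinfeld_twist_inv) \sw_(q1, q2 <- qR)
    (X1 * Y11 * h1 * g1 * S (q2 * Y22) * Y3 ▷ a)
    ⊗ (X2 * Y12 * h2 * g2 * S (X3 * q1 * Y21) : H0).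

Definition diamond : modAlgOps H := twisted_tensor R_diamond.

Definition Pi_diamond (t : diamond) : A ⊗ H :=
  \sw_(a, h <- t : A ⊗ H) \sw_(x1, x2, x3 <- Φ')
    (x1 ▷ a) ⊗ (x2 * h * S x3).

End SmashProduct.

(* Main.v *)
(* Both claims are Sweedler computations: an identity between tensors is used
   in the form that every multilinear map takes the same value on its two
   sides.

   By the pentagon equation the product of B^v also reads
     b b' = Y^1 (z^1 . b) S(Y^2) alpha Y^3 z^2 b' S(z^3),
   and this is what u # v computes on Pi (a (x) h), whereas the decomposition
   a (x) h = (a (x) beta)(1 (x) h) forces w (a (x) h) = u(a) v(h).

   In the product of u and v on R (h (x) a), the outer X of R cancels against
   z, and Delta(Y^1 h) moves through the associator to the left.  Unfolding
   f^{-1} in the remaining expression and applying the pentagon equation, all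
   that survives of it is S(x^1) alpha x^2 and Delta(beta S(x^3_2 C^3) _)
   (lemma sw_cap_twist_inv), so that no property of the Drinfeld twist beyond
   its definition is needed.  What is left of q_R is absorbed by a second
   application of the pentagon equation (lemma sw_cap_twist_qR). *)

Require Import Defs.
From mathcomp Require Import all_boot all_algebra.
From mathcomp Require Import sesquilinear ring.

Set Implicit Arguments.
Unset Strict Implicit.
Unset Printing Implicit Defensive.

Import GRing.Theory.
Local Open Scope ring_scope.

(** * Linearity in Sweedler sums *)

Section Multilinear.
Variable k : fieldType.

Section Defs.
Variables U V X Y W : lmodType k.

(** Multilinearity is kept as a bare proposition about functions, since the maps at stake are
    Sweedler integrands written as anonymous functions; [lin] proves it by following their
    syntax. *)
Definition bilin (F : U -> V -> W) := bilinear_for *:%R *:%R F.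

Definition trilin (F : U -> V -> X -> W) :=
  [/\ forall b c, linear (fun a => F a b c),
      forall a c, linear (fun b => F a b c)
    & forall a b, linear (F a b)].

Definition quadrilin (F : U -> V -> X -> Y -> W) :=
  [/\ forall b c d, linear (fun a => F a b c d),
      forall a c d, linear (fun b => F a b c d),
      forall a b d, linear (fun c => F a b c d)
    & forall a b c, linear (F a b c)].

End Defs.

Lemma linear_id (U : lmodType k) : linear (fun x : U => x).
Proof. by []. Qed.

Lemma linear_comp (U V W : lmodType k) (g : V -> W) (f : U -> V) :
  linear g -> linear f -> linear (fun x => g (f x)).
Proof. by move=> lg lf c x y; rewrite lf lg. Qed.

Lemma linear_add (U V : lmodType k) (f : U -> V) :
  linear f -> {morph f : x y / x + y}.
Proof. by move=> lf x y; have := lf 1 x y; rewrite !scale1r. Qed.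

Lemma linear_zero (U V : lmodType k) (f : U -> V) : linear f -> f 0 = 0.
Proof. by move=> lf; apply: (addrI (f 0)); rewrite -linear_add // !addr0. Qed.

Lemma linear_scale (U V : lmodType k) (f : U -> V) :
  linear f -> forall c x, f (c *: x) = c *: f x.
Proof. by move=> lf c x; have := lf c x 0; rewrite (linear_zero lf) !addr0. Qed.

Lemma linear_big (U V : lmodType k) (f : U -> V) I (r : seq I) (G : I -> U) :
  linear f -> f (\sum_(i <- r) G i) = \sum_(i <- r) f (G i).
Proof.
by move=> lf; exact: (big_morph f (linear_add lf) (linear_zero lf)).
Qed.

Section Algebra.
Variables (U : lmodType k) (B C : assocAlgType k) (V : lmodType k).

Lemma linear_mull (f : U -> B) c : linear f -> linear (fun x => f x * c).
Proof. by move=> lf e x y; rewrite lf mulrDl -alg_scalerAl. Qed.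

Lemma linear_mulr (f : U -> B) c : linear f -> linear (fun x => c * f x).
Proof. by move=> lf e x y; rewrite lf mulrDr -alg_scalerAr. Qed.

End Algebra.

Lemma linear_scaler (U V : lmodType k) (f : U -> V) (c : k) :
  linear f -> linear (fun x => c *: f x).
Proof. by move=> lf e x y; rewrite lf scalerDr !scalerA mulrC. Qed.

Lemma linear_purel (U V W : lmodType k) (f : U -> V) (w : W) :
  linear f -> linear (fun x => f x ⊗ w).
Proof. by move=> lf c x y; rewrite lf pure_tensorDl pure_tensorZl. Qed.

Lemma linear_purer (U V W : lmodType k) (f : U -> V) (w : W) :
  linear f -> linear (fun x => w ⊗ f x).
Proof. by move=> lf c x y; rewrite lf pure_tensorDr pure_tensorZr. Qed.

(** The representative of [t] is fixed, so linearity of each summand passes to the finite sum. *)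
Lemma linear_tsum_body (U V X W : lmodType k) (t : V ⊗ X)
    (G : U -> V -> X -> W) :
  (forall a b, linear (fun x => G x a b)) -> linear (fun x => tsum t (G x)).
Proof.
move=> lG c x y; rewrite /tsum /bilin_sum scaler_sumr -big_split.
by apply: eq_bigr => p _; rewrite lG.
Qed.

(** Here the chosen representative varies with [x], and not additively; bilinearity of [G] makes the
    sum depend on the tensor alone ([tsum_linear]). *)
Lemma linear_tsum_index (U V X W : lmodType k) (f : U -> V ⊗ X)
    (G : V -> X -> W) :
  linear f -> bilin G -> linear (fun x => tsum (f x) G).
Proof. by move=> lf lG; exact: (linear_comp (tsum_linear lG) lf). Qed.

Lemma bilin_comp1 (U V X W : lmodType k) (F : U -> V -> W) (f : X -> U) b :
  bilin F -> linear f -> linear (fun x => F (f x) b).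
Proof. by case=> lF _ lf; exact: (linear_comp (lF b) lf). Qed.

Lemma bilin_comp2 (U V X W : lmodType k) (F : U -> V -> W) (f : X -> V) a :
  bilin F -> linear f -> linear (fun x => F a (f x)).
Proof. by case=> _ lF lf; exact: (linear_comp (lF a) lf). Qed.

Section Comp.
Variables (U V X Y W Z : lmodType k).

Lemma trilin_comp1 (F : U -> V -> X -> W) (f : Z -> U) b c :
  trilin F -> linear f -> linear (fun x => F (f x) b c).
Proof. by case=> lF _ _ lf; exact: (linear_comp (lF b c) lf). Qed.
Lemma trilin_comp2 (F : U -> V -> X -> W) (f : Z -> V) a c :
  trilin F -> linear f -> linear (fun x => F a (f x) c).
Proof. by case=> _ lF _ lf; exact: (linear_comp (lF a c) lf). Qed.
Lemma trilin_comp3 (F : U -> V -> X -> W) (f : Z -> X) a b :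
  trilin F -> linear f -> linear (fun x => F a b (f x)).
Proof. by case=> _ _ lF lf; exact: (linear_comp (lF a b) lf). Qed.

Lemma quadrilin_comp1 (F : U -> V -> X -> Y -> W) (f : Z -> U) b c d :
  quadrilin F -> linear f -> linear (fun x => F (f x) b c d).
Proof. by case=> lF _ _ _ lf; exact: (linear_comp (lF b c d) lf). Qed.
Lemma quadrilin_comp2 (F : U -> V -> X -> Y -> W) (f : Z -> V) a c d :
  quadrilin F -> linear f -> linear (fun x => F a (f x) c d).
Proof. by case=> _ lF _ _ lf; exact: (linear_comp (lF a c d) lf). Qed.
Lemma quadrilin_comp3 (F : U -> V -> X -> Y -> W) (f : Z -> X) a b d :
  quadrilin F -> linear f -> linear (fun x => F a b (f x) d).
Proof. by case=> _ _ lF _ lf; exact: (linear_comp (lF a b d) lf). Qed.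
Lemma quadrilin_comp4 (F : U -> V -> X -> Y -> W) (f : Z -> Y) a b c :
  quadrilin F -> linear f -> linear (fun x => F a b c (f x)).
Proof. by case=> _ _ _ lF lf; exact: (linear_comp (lF a b c) lf). Qed.
End Comp.

Lemma eq_tsum (U V : lmodType k) (W : zmodType) (t : U ⊗ V)
    (F G : U -> V -> W) :
  (forall a b, F a b = G a b) -> tsum t F = tsum t G.
Proof. by move=> FG; apply: eq_bigr => p _; exact: FG. Qed.

(** Each Sweedler sum is a finite sum over a chosen representative, so this is an exchange of big
    sums. *)
Lemma tsum_exch (U V U' V' : lmodType k) (W : zmodType) (s : U ⊗ V)
    (t : U' ⊗ V') (F : U -> V -> U' -> V' -> W) :
  \sw_(a, b <- s) \sw_(c, d <- t) F a b c d
  = \sw_(c, d <- t) \sw_(a, b <- s) F a b c d.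
Proof. exact: exchange_big. Qed.

Lemma linear_tsum (U V W W' : lmodType k) (f : W -> W') (t : U ⊗ V)
    (G : U -> V -> W) :
  linear f -> f (tsum t G) = \sw_(a, b <- t) f (G a b).
Proof. exact: linear_big. Qed.

End Multilinear.

Lemma linear_comul (k : fieldType) (H : quasiBialgebra k) : linear (@comul k H).
Proof. by case: (comul_algebra_map H). Qed.

Lemma linear_counit_scale (k : fieldType) (H : quasiBialgebra k)
    (V : lmodType k) (w : V) :
  linear (fun h : H => counit h *: w).
Proof.
by case: (counit_algebra_map H) => lc _ _ c x y; rewrite lc scalerDl scalerA.
Qed.

(* Proves [linear], [bilin], [trilin] and [quadrilin] goals by following the  *)
(* path from the root of the expression to the unique occurrence of the       *)
(* variable; hypotheses of the same kinds are used for opaque heads.          *)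
Ltac lin :=
  cbv beta;
  lazymatch goal with
  | |- bilin _ => split=> ?; lin
  | |- bilinear_for _ _ _ => split=> ?; lin
  | |- trilin _ => split=> ? ?; lin
  | |- quadrilin _ => split=> ? ? ?; lin
  | |- GRing.linear_for _ (fun x => x) => exact: linear_id
  | |- GRing.linear_for _ (fun x => tsum (@?f x) (@?G x)) =>
      lazymatch G with
      | (fun _ => ?G0) => apply: (linear_tsum_index (f := f) (G := G0))
      | _ => apply: (linear_tsum_body _ (G := G)) => ? ?
      end; lin
  | |- GRing.linear_for _ (fun x => @?f x * @?g x) =>
      first [ apply: (linear_mull (f := f)) | apply: (linear_mulr (f := g)) ];
      lin
  | |- GRing.linear_for _ (fun x => @?f x ⊗ @?g x) =>
      first [ apply: (linear_purel (f := f))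
            | apply: (linear_purer (f := g)) ]; lin
  | |- GRing.linear_for _ (fun x => comul (@?f x)) =>
      apply: (linear_comp (f := f) (@linear_comul _ _)); lin
  | |- GRing.linear_for _ (fun x => antipode (@?f x)) =>
      apply: (linear_comp (f := f) (@antipode_linear _ _)); lin
  | |- GRing.linear_for _ (fun x => counit (@?f x) *: @?g x) =>
      first [ apply: (linear_scaler (f := g))
            | apply: (linear_comp (f := f) (linear_counit_scale _)) ]; lin
  | |- GRing.linear_for _ (fun x => _ *: @?g x) =>
      apply: (linear_scaler (f := g)); lin
  | _ => lin_hyp
  end
with lin_hyp :=
  match goal with
  | hF : linear ?F |- GRing.linear_for _ ?F => exact: hF
  | hF : bilin ?F |- GRing.linear_for _ (?F ?a) => exact: hF.2
  | hF : trilin ?F |- GRing.linear_for _ (?F ?a ?b) =>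
      by case: hF => _ _; apply
  | hF : quadrilin ?F |- GRing.linear_for _ (?F ?a ?b ?c) =>
      by case: hF => _ _ _; apply
  | hF : linear ?F |- GRing.linear_for _ (fun x => ?F (@?f x)) =>
      apply: (linear_comp (f := f) hF); lin
  | hF : bilin ?F |- GRing.linear_for _ (fun x => ?F (@?f x) (@?g x)) =>
      first [ apply: (bilin_comp1 (f := f) _ hF)
            | apply: (bilin_comp2 (f := g) _ hF) ]; lin
  | hF : trilin ?F |- GRing.linear_for _
        (fun x => ?F (@?f x) (@?g x) (@?h x)) =>
      first [ apply: (trilin_comp1 (f := f) _ _ hF)
            | apply: (trilin_comp2 (f := g) _ _ hF)
            | apply: (trilin_comp3 (f := h) _ _ hF) ]; lin
  | hF : quadrilin ?F |- GRing.linear_for _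
        (fun x => ?F (@?f x) (@?g x) (@?h x) (@?i x)) =>
      first [ apply: (quadrilin_comp1 (f := f) _ _ _ hF)
            | apply: (quadrilin_comp2 (f := g) _ _ _ hF)
            | apply: (quadrilin_comp3 (f := h) _ _ _ hF)
            | apply: (quadrilin_comp4 (f := i) _ _ _ hF) ]; lin
  end.

(** * The pentagon equation *)

Ltac sw_ext := repeat (apply: eq_tsum => ? ?).

(** * Evaluation of multilinear maps on tensor powers *)

Section Expand.
Variable k : fieldType.

(** The passage from equations between tensors to Sweedler sums: a factor of a product is replaced
    by its pure summands, on which the product is computed leg by leg. *)
Lemma linear_expand (U V W : lmodType k) (f : U ⊗ V -> W) t :
  linear f -> f t = \sw_(a, b <- t) f (a ⊗ b).
Proof. by move=> lf; rewrite {1}(tensor_sum_pure t) linear_tsum. Qed.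

Lemma linear_expand3 (U V X W : lmodType k) (f : U ⊗ V ⊗ X -> W) t :
  linear f -> f t = \sw_(a, b, c <- t) f (a ⊗ b ⊗ c).
Proof.
move=> lf; rewrite linear_expand //; apply: eq_tsum => s c.
by rewrite (linear_expand (f := fun s => f (s ⊗ c))) //; lin.
Qed.

Lemma tsum3_pure (U V X W : lmodType k) (F : U -> V -> X -> W) a b c :
  trilin F -> \sw_(x, y, z <- a ⊗ b ⊗ c) F x y z = F a b c.
Proof. by move=> hF; rewrite tsum_pure ?tsum_pure //; lin. Qed.

Definition eval4 (U V X Y W : lmodType k) (F : U -> V -> X -> Y -> W) t :=
  \sw_(x, y, z, w <- t) F x y z w.

Section Eval4.
Variables (U V X Y W : lmodType k) (F : U -> V -> X -> Y -> W).
Hypothesis hF : quadrilin F.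

Lemma eval4_linear : linear (eval4 F).
Proof. by rewrite /eval4; lin. Qed.

Lemma eval4_pure a b c d : eval4 F (a ⊗ b ⊗ c ⊗ d) = F a b c d.
Proof. by rewrite /eval4 tsum_pure ?tsum3_pure //; lin. Qed.

End Eval4.

Lemma tsum_mulr (U V : lmodType k) (C : assocAlgType k) (t : U ⊗ V)
    (F : U -> V -> C) c :
  tsum t F * c = \sw_(a, b <- t) F a b * c.
Proof. by rewrite (linear_tsum (f := fun x : C => x * c)) //; lin. Qed.

Lemma tsum_mull (U V : lmodType k) (C : assocAlgType k) (t : U ⊗ V)
    (F : U -> V -> C) c :
  c * tsum t F = \sw_(a, b <- t) c * F a b.
Proof. by rewrite (linear_tsum (f := fun x : C => c * x)) //; lin. Qed.

Section Algebra.
Variable H : assocAlgType k.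

Lemma tensor2_mul_pure (a b c d : H) :
  (a ⊗ b) * (c ⊗ d) = (a * c) ⊗ (b * d).
Proof. exact: tensor_mul_pure. Qed.

Lemma tensor3_mul_pure (a b c a' b' c' : H) :
  (a ⊗ b ⊗ c) * (a' ⊗ b' ⊗ c') = (a * a') ⊗ (b * b') ⊗ (c * c').
Proof.
by rewrite [LHS]tensor_mul_pure; congr (_ ⊗ _); exact: tensor_mul_pure.
Qed.

Lemma tensor4_mul_pure (a b c d a' b' c' d' : H) :
  (a ⊗ b ⊗ c ⊗ d) * (a' ⊗ b' ⊗ c' ⊗ d')
  = (a * a') ⊗ (b * b') ⊗ (c * c') ⊗ (d * d').
Proof.
by rewrite [LHS]tensor_mul_pure; congr (_ ⊗ _); exact: tensor3_mul_pure.
Qed.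

(** Both sides are linear in [s] and in [t], so each argument in turn may be replaced by pure
    tensors. *)
Lemma tensor3_morph (C : assocAlgType k) (f : H ⊗ H ⊗ H -> C) :
  linear f ->
  (forall a b c a' b' c' : H,
     f ((a * a') ⊗ (b * b') ⊗ (c * c')) = f (a ⊗ b ⊗ c) * f (a' ⊗ b' ⊗ c')) ->
  {morph f : s t / s * t}.
Proof.
move=> lf fM s t.
rewrite (linear_expand3 (f := fun s => f (s * t))); last by lin.
rewrite (linear_expand3 (f := fun s => f s * f t)); last by lin.
sw_ext; set s0 := (X in f (X * t)).
rewrite (linear_expand3 (f := fun t => f (s0 * t))); last by lin.
rewrite (linear_expand3 (f := fun t => f s0 * f t)); last by lin.
by sw_ext; rewrite tensor3_mul_pure fM.
Qed.

End Algebra.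
End Expand.

Section QuasiBialgebra.
Variables (k : fieldType) (H : quasiBialgebra k).
Local Notation Φ := (@reassoc k H).
Local Notation Φ' := (@reassoc_inv k H).
Implicit Types h x y z : H.

Section Comul.
Variables (W : lmodType k) (F : H -> H -> W).
Hypothesis hF : bilin F.

Lemma sw_comulM x y :
  \sw_(a, b <- comul (x * y)) F a b
  = \sw_(a, b <- comul x) \sw_(c, d <- comul y) F (a * c) (b * d).
Proof.
have [_ cM _] := comul_algebra_map H.
rewrite cM -[comul x * _]/(tensor_mul _ _) /tensor_mul.
rewrite (linear_tsum (f := fun t => tsum t F)); last by lin.
sw_ext; rewrite (linear_tsum (f := fun t => tsum t F)); last by lin.
by sw_ext; rewrite tsum_pure.
Qed.

Lemma sw_comul1 : \sw_(a, b <- comul (1 : H)) F a b = F 1 1.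
Proof.
have [_ _ ->] := comul_algebra_map H.
exact: tsum_pure.
Qed.

End Comul.

Lemma sw_counitr (W : lmodType k) (f : H -> W) h :
  linear f -> \sw_(a, b <- comul h) counit b *: f a = f h.
Proof.
move=> lf; rewrite -{2}(comul_counitr h) (linear_tsum _ _ lf).
by sw_ext; rewrite linear_scale.
Qed.

Lemma sw_counitl (W : lmodType k) (f : H -> W) h :
  linear f -> \sw_(a, b <- comul h) counit a *: f b = f h.
Proof.
move=> lf; rewrite -{2}(comul_counitl h) (linear_tsum _ _ lf).
by sw_ext; rewrite linear_scale.
Qed.

(** These five maps carry the associator to the factors of the pentagon equation. As unital
    multiplicative maps they can be applied to [Φ'] too, which supplies the inverses of the
    factors. *)
Definition legs234 (t : H ⊗ H ⊗ H) : H ⊗ H ⊗ H ⊗ H :=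
  \sw_(a, b, c <- t) (1 : H) ⊗ a ⊗ b ⊗ c.
Definition legs123 (t : H ⊗ H ⊗ H) : H ⊗ H ⊗ H ⊗ H := t ⊗ (1 : H).
Definition comul_leg1 (t : H ⊗ H ⊗ H) : H ⊗ H ⊗ H ⊗ H :=
  \sw_(a, b, c <- t) comul a ⊗ b ⊗ c.
Definition comul_leg2 (t : H ⊗ H ⊗ H) : H ⊗ H ⊗ H ⊗ H :=
  \sw_(a, b, c <- t) \sw_(p, q <- comul b) a ⊗ p ⊗ q ⊗ c.
Definition comul_leg3 (t : H ⊗ H ⊗ H) : H ⊗ H ⊗ H ⊗ H :=
  \sw_(a, b, c <- t) \sw_(p, q <- comul c) a ⊗ b ⊗ p ⊗ q.

Let lin234 : linear legs234. Proof. by rewrite /legs234; lin. Qed.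
Let lin123 : linear legs123. Proof. by rewrite /legs123; lin. Qed.
Let linc1 : linear comul_leg1. Proof. by rewrite /comul_leg1; lin. Qed.
Let linc2 : linear comul_leg2. Proof. by rewrite /comul_leg2; lin. Qed.
Let linc3 : linear comul_leg3. Proof. by rewrite /comul_leg3; lin. Qed.

Lemma legs234_pure a b c : legs234 (a ⊗ b ⊗ c) = 1 ⊗ a ⊗ b ⊗ c.
Proof. by rewrite /legs234 tsum3_pure //; lin. Qed.
Lemma comul_leg1_pure a b c :
  comul_leg1 (a ⊗ b ⊗ c) = \sw_(p, q <- comul a) p ⊗ q ⊗ b ⊗ c.
Proof.
rewrite /comul_leg1 tsum3_pure; last by lin.
by rewrite (linear_expand (f := fun t => t ⊗ b ⊗ c)) //; lin.
Qed.
Lemma comul_leg2_pure a b c :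
  comul_leg2 (a ⊗ b ⊗ c) = \sw_(p, q <- comul b) a ⊗ p ⊗ q ⊗ c.
Proof. by rewrite /comul_leg2 tsum3_pure //; lin. Qed.
Lemma comul_leg3_pure a b c :
  comul_leg3 (a ⊗ b ⊗ c) = \sw_(p, q <- comul c) a ⊗ b ⊗ p ⊗ q.
Proof. by rewrite /comul_leg3 tsum3_pure //; lin. Qed.

Lemma legs234M : {morph legs234 : s t / s * t}.
Proof.
by apply: tensor3_morph => // *; rewrite !legs234_pure tensor4_mul_pure mul1r.
Qed.
Lemma legs123M : {morph legs123 : s t / s * t}.
Proof.
by move=> s t; rewrite /legs123 -[RHS]/(tensor_mul _ _) tensor_mul_pure mul1r.
Qed.

Lemma comul_leg1M : {morph comul_leg1 : s t / s * t}.
Proof.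
apply: tensor3_morph => // a b c a' b' c'.
rewrite !comul_leg1_pure sw_comulM ?tsum_mulr; last by lin.
by sw_ext; rewrite tsum_mull; sw_ext; rewrite tensor4_mul_pure.
Qed.
Lemma comul_leg2M : {morph comul_leg2 : s t / s * t}.
Proof.
apply: tensor3_morph => // a b c a' b' c'.
rewrite !comul_leg2_pure sw_comulM ?tsum_mulr; last by lin.
by sw_ext; rewrite tsum_mull; sw_ext; rewrite tensor4_mul_pure.
Qed.
Lemma comul_leg3M : {morph comul_leg3 : s t / s * t}.
Proof.
apply: tensor3_morph => // a b c a' b' c'.
rewrite !comul_leg3_pure sw_comulM ?tsum_mulr; last by lin.
by sw_ext; rewrite tsum_mull; sw_ext; rewrite tensor4_mul_pure.
Qed.

Let one3 : (1 : H ⊗ H ⊗ H) = (1 : H) ⊗ (1 : H) ⊗ (1 : H). Proof. by []. Qed.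
Lemma legs234_1 : legs234 1 = 1.
Proof. by rewrite one3 legs234_pure. Qed.
Lemma legs123_1 : legs123 1 = 1.
Proof. by []. Qed.
Lemma comul_leg1_1 : comul_leg1 1 = 1.
Proof. by rewrite one3 comul_leg1_pure sw_comul1 //; lin. Qed.
Lemma comul_leg2_1 : comul_leg2 1 = 1.
Proof. by rewrite one3 comul_leg2_pure sw_comul1 //; lin. Qed.
Lemma comul_leg3_1 : comul_leg3 1 = 1.
Proof. by rewrite one3 comul_leg3_pure sw_comul1 //; lin. Qed.

Lemma reassoc_image_inv (f : H ⊗ H ⊗ H -> H ⊗ H ⊗ H ⊗ H) :
  {morph f : s t / s * t} -> f 1 = 1 -> f Φ * f Φ' = 1 /\ f Φ' * f Φ = 1.
Proof. by move=> fM f1; rewrite -!fM reassoc_mulV reassoc_mulVl. Qed.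

Lemma pentagon :
  legs234 Φ * comul_leg2 Φ * legs123 Φ = comul_leg3 Φ * comul_leg1 Φ.
Proof. exact: reassoc_pentagon. Qed.

(** The pentagon equation multiplied by [legs234 Φ'] on the left and by [comul_leg1 Φ'] on the
    right. *)
Lemma pentagon1 :
  legs234 Φ' * comul_leg3 Φ = comul_leg2 Φ * legs123 Φ * comul_leg1 Φ'.
Proof.
have [_ a] := reassoc_image_inv legs234M legs234_1.
have [e _] := reassoc_image_inv comul_leg1M comul_leg1_1.
rewrite -[LHS]mulr1 -e !mulrA -(mulrA _ (comul_leg3 Φ)) -pentagon.
by rewrite !mulrA a mul1r.
Qed.

(** The pentagon equation multiplied by [comul_leg3 Φ'] on the left and by [legs123 Φ'] on the
    right. *)
Lemma pentagon2 :
  comul_leg1 Φ * legs123 Φ' = comul_leg3 Φ' * legs234 Φ * comul_leg2 Φ.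
Proof.
have [_ d] := reassoc_image_inv comul_leg3M comul_leg3_1.
have [c _] := reassoc_image_inv legs123M legs123_1.
rewrite -[LHS]mul1r -d !mulrA -(mulrA _ (comul_leg3 Φ)) -pentagon.
by rewrite !mulrA -(mulrA _ (legs123 _)) c mulr1.
Qed.

Lemma pentagon3 :
  comul_leg3 Φ' * legs234 Φ = comul_leg1 Φ * legs123 Φ' * comul_leg2 Φ'.
Proof.
have [b _] := reassoc_image_inv comul_leg2M comul_leg2_1.
by rewrite pentagon2 -mulrA b mulr1.
Qed.

(** * The rearranged pentagon equations in Sweedler form *)

Section Pentagon.
Variables (W : lmodType k) (F : H -> H -> H -> H -> W).
Hypothesis hF : quadrilin F.
Let linF := eval4_linear hF.

Lemma sw_pentagon1 :
  \sw_(x1, x2, x3 <- Φ') \sw_(X1, X2, X3 <- Φ) \sw_(X31, X32 <- comul X3)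
     F X1 (x1 * X2) (x2 * X31) (x3 * X32)
  = \sw_(X1, X2, X3 <- Φ) \sw_(Y1, Y2, Y3 <- Φ) \sw_(z1, z2, z3 <- Φ')
    \sw_(X21, X22 <- comul X2) \sw_(z11, z12 <- comul z1)
     F (X1 * Y1 * z11) (X21 * Y2 * z12) (X22 * Y3 * z2) (X3 * z3).
Proof.
transitivity (eval4 F (legs234 Φ' * comul_leg3 Φ)); last rewrite pentagon1.
  rewrite (linear_expand3 (f := fun t => eval4 F (legs234 t * _))); last by lin.
  apply: eq_tsum => s x3; apply: eq_tsum => x1 x2.
  rewrite (linear_expand3 (f := fun t => eval4 F (_ * comul_leg3 t)));
    last by lin.
  apply: eq_tsum => s' X3; apply: eq_tsum => X1 X2.
  rewrite comul_leg3_pure legs234_pure (tsum_mull (comul X3))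
    (linear_tsum (comul X3) _ linF).
  by sw_ext; rewrite tensor4_mul_pure eval4_pure // mul1r.
rewrite (linear_expand3 (f := fun t => eval4 F (comul_leg2 t * _ * _)));
  last by lin.
apply: eq_tsum => s X3; apply: eq_tsum => X1 X2.
rewrite (linear_expand3 (f := fun t => eval4 F (_ * legs123 t * _)));
  last by lin.
apply: eq_tsum => s' Y3; apply: eq_tsum => Y1 Y2.
rewrite (linear_expand3 (f := fun t => eval4 F (_ * comul_leg1 t)));
  last by lin.
apply: eq_tsum => s'' z3; apply: eq_tsum => z1 z2.
rewrite comul_leg2_pure comul_leg1_pure !(tsum_mulr (comul X2))
  (linear_tsum (comul X2) _ linF).
apply: eq_tsum => p q; rewrite (tsum_mull (comul z1))
  (linear_tsum (comul z1) _ linF).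
by sw_ext; rewrite !tensor4_mul_pure eval4_pure // mulr1.
Qed.

(** This product is one side of [pentagon2] and also the element $B$ in the definition of
    [twist_delta], so its evaluation is shared. *)
Lemma sw_comul_leg1_inv :
  eval4 F (comul_leg1 Φ * legs123 Φ')
  = \sw_(X1, X2, X3 <- Φ) \sw_(x1, x2, x3 <- Φ') \sw_(X11, X12 <- comul X1)
     F (X11 * x1) (X12 * x2) (X2 * x3) X3.
Proof.
rewrite (linear_expand3 (f := fun t => eval4 F (comul_leg1 t * _)));
  last by lin.
apply: eq_tsum => s X3; apply: eq_tsum => X1 X2.
rewrite (linear_expand3 (f := fun t => eval4 F (_ * legs123 t)));
  last by lin.
apply: eq_tsum => s' x3; apply: eq_tsum => x1 x2.
rewrite comul_leg1_pure (tsum_mulr (comul X1)) (linear_tsum (comul X1) _ linF).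
by sw_ext; rewrite tensor4_mul_pure eval4_pure // mulr1.
Qed.

Lemma sw_pentagon2 :
  \sw_(X1, X2, X3 <- Φ) \sw_(x1, x2, x3 <- Φ') \sw_(X11, X12 <- comul X1)
     F (X11 * x1) (X12 * x2) (X2 * x3) X3
  = \sw_(x1, x2, x3 <- Φ') \sw_(Y1, Y2, Y3 <- Φ) \sw_(Z1, Z2, Z3 <- Φ)
    \sw_(x31, x32 <- comul x3) \sw_(Z21, Z22 <- comul Z2)
     F (x1 * Z1) (x2 * Y1 * Z21) (x31 * Y2 * Z22) (x32 * Y3 * Z3).
Proof.
rewrite -sw_comul_leg1_inv pentagon2.
rewrite (linear_expand3 (f := fun t => eval4 F (comul_leg3 t * _ * _)));
  last by lin.
apply: eq_tsum => s x3; apply: eq_tsum => x1 x2.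
rewrite (linear_expand3 (f := fun t => eval4 F (_ * legs234 t * _)));
  last by lin.
apply: eq_tsum => s' Y3; apply: eq_tsum => Y1 Y2.
rewrite (linear_expand3 (f := fun t => eval4 F (_ * comul_leg2 t)));
  last by lin.
apply: eq_tsum => s'' Z3; apply: eq_tsum => Z1 Z2.
rewrite comul_leg3_pure comul_leg2_pure legs234_pure !(tsum_mulr (comul x3)).
rewrite (linear_tsum (comul x3) _ linF).
apply: eq_tsum => p q; rewrite (tsum_mull (comul Z2))
  (linear_tsum (comul Z2) _ linF).
by sw_ext; rewrite !tensor4_mul_pure eval4_pure // mulr1.
Qed.

Lemma sw_pentagon3 :
  \sw_(x1, x2, x3 <- Φ') \sw_(Y1, Y2, Y3 <- Φ) \sw_(x31, x32 <- comul x3)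
     F x1 (x2 * Y1) (x31 * Y2) (x32 * Y3)
  = \sw_(X1, X2, X3 <- Φ) \sw_(y1, y2, y3 <- Φ') \sw_(z1, z2, z3 <- Φ')
    \sw_(X11, X12 <- comul X1) \sw_(z21, z22 <- comul z2)
     F (X11 * y1 * z1) (X12 * y2 * z21) (X2 * y3 * z22) (X3 * z3).
Proof.
transitivity (eval4 F (comul_leg3 Φ' * legs234 Φ)); last rewrite pentagon3.
  rewrite (linear_expand3 (f := fun t => eval4 F (comul_leg3 t * _)));
    last by lin.
  apply: eq_tsum => s x3; apply: eq_tsum => x1 x2.
  rewrite (linear_expand3 (f := fun t => eval4 F (_ * legs234 t)));
    last by lin.
  apply: eq_tsum => s' Y3; apply: eq_tsum => Y1 Y2.
  rewrite comul_leg3_pure legs234_pure (tsum_mulr (comul x3))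
    (linear_tsum (comul x3) _ linF).
  by sw_ext; rewrite tensor4_mul_pure eval4_pure // mulr1.
rewrite (linear_expand3 (f := fun t => eval4 F (comul_leg1 t * _ * _)));
  last by lin.
apply: eq_tsum => s X3; apply: eq_tsum => X1 X2.
rewrite (linear_expand3 (f := fun t => eval4 F (_ * legs123 t * _)));
  last by lin.
apply: eq_tsum => s' y3; apply: eq_tsum => y1 y2.
rewrite (linear_expand3 (f := fun t => eval4 F (_ * comul_leg2 t)));
  last by lin.
apply: eq_tsum => s'' z3; apply: eq_tsum => z1 z2.
rewrite comul_leg1_pure comul_leg2_pure !(tsum_mulr (comul X1))
  (linear_tsum (comul X1) _ linF).
apply: eq_tsum => p q; rewrite (tsum_mull (comul z2))
  (linear_tsum (comul z2) _ linF).
by sw_ext; rewrite !tensor4_mul_pure eval4_pure // mulr1.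
Qed.

End Pentagon.
End QuasiBialgebra.

(** * Coassociativity and counits *)

Section Counit.
Variables (k : fieldType) (H : quasiBialgebra k).
Local Notation Φ := (@reassoc k H).
Local Notation Φ' := (@reassoc_inv k H).
Local Notation ε := (@counit k H).

Lemma sw_reassoc_invl (W : lmodType k) (F : H -> H -> H -> W) :
  trilin F ->
  \sw_(x1, x2, x3 <- Φ') \sw_(X1, X2, X3 <- Φ) F (x1 * X1) (x2 * X2) (x3 * X3)
  = F 1 1 1.
Proof.
move=> hF; pose ev t := \sw_(a, b, c <- t) F a b c.
have lev : linear ev by rewrite /ev; lin.
transitivity (ev (Φ' * Φ)); last by rewrite reassoc_mulVl /ev tsum3_pure.
rewrite (linear_expand3 (f := fun t => ev (t * _))); last by lin.
apply: eq_tsum => s x3; apply: eq_tsum => x1 x2.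
rewrite (linear_expand3 (f := fun t => ev (_ * t))); last by lin.
apply: eq_tsum => s' X3; apply: eq_tsum => X1 X2.
by rewrite tensor3_mul_pure /ev tsum3_pure.
Qed.

Section Coassoc.
Variables (W : lmodType k) (F : H -> H -> H -> W).
Hypothesis hF : trilin F.
Let ev t := \sw_(a, b, c <- t) F a b c.
Let lev : linear ev. Proof. by rewrite /ev; lin. Qed.
Let ev_pure a b c : ev (a ⊗ b ⊗ c) = F a b c.
Proof. by rewrite /ev tsum3_pure. Qed.

Let coassocl (h : H) : H ⊗ H ⊗ H := \sw_(h1, h2 <- comul h) comul h1 ⊗ h2.
Let coassocr (h : H) : H ⊗ H ⊗ H :=
  \sw_(h1, h2 <- comul h) \sw_(h21, h22 <- comul h2) h1 ⊗ h21 ⊗ h22.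

Let coassoclE h :
  coassocl h = \sw_(h1, h2 <- comul h) \sw_(h11, h12 <- comul h1) h11 ⊗ h12 ⊗ h2.
Proof.
apply: eq_tsum => h1 h2.
by rewrite (linear_expand (f := fun t => t ⊗ h2)) //; lin.
Qed.

(** Clearing one of the two associators of the conjugation leaves [Φ], or [Φ'] in the next equation,
    intertwining the two iterated coproducts. *)
Let coassocE h : coassocr h * Φ = Φ * coassocl h.
Proof.
by rewrite [coassocr h]comul_quasi_coassoc -!mulrA reassoc_mulVl mulr1.
Qed.

Let coassoc_invE h : Φ' * coassocr h = coassocl h * Φ'.
Proof.
by rewrite [coassocr h]comul_quasi_coassoc !mulrA reassoc_mulVl mul1r.
Qed.

Lemma sw_coassoc (h : H) :
  \sw_(X1, X2, X3 <- Φ) \sw_(h1, h2 <- comul h) \sw_(h11, h12 <- comul h1)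
     F (X1 * h11) (X2 * h12) (X3 * h2)
  = \sw_(X1, X2, X3 <- Φ) \sw_(h1, h2 <- comul h) \sw_(h21, h22 <- comul h2)
     F (h1 * X1) (h21 * X2) (h22 * X3).
Proof.
transitivity (ev (Φ * coassocl h)); last rewrite -coassocE.
  rewrite (linear_expand3 (f := fun t => ev (t * _))); last by lin.
  apply: eq_tsum => s X3; apply: eq_tsum => X1 X2.
  rewrite coassoclE (tsum_mull (comul h)) (linear_tsum (comul h) _ lev).
  apply: eq_tsum => h1 h2.
  rewrite (tsum_mull (comul h1)) (linear_tsum (comul h1) _ lev).
  by apply: eq_tsum => h11 h12; rewrite tensor3_mul_pure ev_pure.
rewrite (linear_expand3 (f := fun t => ev (_ * t))); last by lin.
apply: eq_tsum => s X3; apply: eq_tsum => X1 X2.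
rewrite (tsum_mulr (comul h)) (linear_tsum (comul h) _ lev).
apply: eq_tsum => h1 h2.
rewrite (tsum_mulr (comul h2)) (linear_tsum (comul h2) _ lev).
by apply: eq_tsum => h21 h22; rewrite tensor3_mul_pure ev_pure.
Qed.

Lemma sw_coassoc_inv (h : H) :
  \sw_(x1, x2, x3 <- Φ') \sw_(h1, h2 <- comul h) \sw_(h21, h22 <- comul h2)
     F (x1 * h1) (x2 * h21) (x3 * h22)
  = \sw_(x1, x2, x3 <- Φ') \sw_(h1, h2 <- comul h) \sw_(h11, h12 <- comul h1)
     F (h11 * x1) (h12 * x2) (h2 * x3).
Proof.
transitivity (ev (Φ' * coassocr h)); last rewrite coassoc_invE.
  rewrite (linear_expand3 (f := fun t => ev (t * _))); last by lin.
  apply: eq_tsum => s x3; apply: eq_tsum => x1 x2.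
  rewrite (tsum_mull (comul h)) (linear_tsum (comul h) _ lev).
  apply: eq_tsum => h1 h2.
  rewrite (tsum_mull (comul h2)) (linear_tsum (comul h2) _ lev).
  by apply: eq_tsum => h21 h22; rewrite tensor3_mul_pure ev_pure.
rewrite (linear_expand3 (f := fun t => ev (_ * t))); last by lin.
apply: eq_tsum => s x3; apply: eq_tsum => x1 x2.
rewrite coassoclE (tsum_mulr (comul h)) (linear_tsum (comul h) _ lev).
apply: eq_tsum => h1 h2.
rewrite (tsum_mulr (comul h1)) (linear_tsum (comul h1) _ lev).
by apply: eq_tsum => h11 h12; rewrite tensor3_mul_pure ev_pure.
Qed.

End Coassoc.

(** * Counit identities for the associator and its inverse *)

Lemma counitM : {morph ε : x y / x * y}.
Proof. by case: (counit_algebra_map H). Qed.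
Lemma counit1 : ε 1 = 1.
Proof. by case: (counit_algebra_map H). Qed.
(** The counit axioms concern [Φ]. Applying [ε] to one leg is multiplicative and unital, which
    transports them to [Φ']. *)
Definition counit_leg1 (t : H ⊗ H ⊗ H) : H ⊗ H :=
  \sw_(a, b, c <- t) ε a *: (b ⊗ c).
Definition counit_leg2 (t : H ⊗ H ⊗ H) : H ⊗ H :=
  \sw_(a, b, c <- t) ε b *: (a ⊗ c).
Definition counit_leg3 (t : H ⊗ H ⊗ H) : H ⊗ H :=
  \sw_(a, b, c <- t) ε c *: (a ⊗ b).

Let scale_mul (c d : k) (s t : H ⊗ H) :
  (c *: s) * (d *: t) = (c * d) *: (s * t).
Proof. by rewrite -alg_scalerAl -alg_scalerAr scalerA. Qed.

Lemma counit_leg1M : {morph counit_leg1 : s t / s * t}.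
Proof.
apply: tensor3_morph => [|a b c a' b' c']; first by rewrite /counit_leg1; lin.
rewrite /counit_leg1 !tsum3_pure; try by lin.
by rewrite scale_mul tensor2_mul_pure counitM.
Qed.
Lemma counit_leg2M : {morph counit_leg2 : s t / s * t}.
Proof.
apply: tensor3_morph => [|a b c a' b' c']; first by rewrite /counit_leg2; lin.
rewrite /counit_leg2 !tsum3_pure; try by lin.
by rewrite scale_mul tensor2_mul_pure counitM.
Qed.
Lemma counit_leg3M : {morph counit_leg3 : s t / s * t}.
Proof.
apply: tensor3_morph => [|a b c a' b' c']; first by rewrite /counit_leg3; lin.
rewrite /counit_leg3 !tsum3_pure; try by lin.
by rewrite scale_mul tensor2_mul_pure counitM.
Qed.

Lemma counit_leg_inv (f : H ⊗ H ⊗ H -> H ⊗ H) :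
  {morph f : s t / s * t} -> f 1 = 1 -> f Φ = 1 -> f Φ' = 1.
Proof.
by move=> fM f1 fΦ; rewrite -[LHS]mulr1 -[in LHS]fΦ -fM reassoc_mulVl.
Qed.

Lemma counit_leg1_inv : counit_leg1 Φ' = 1.
Proof.
apply: (counit_leg_inv counit_leg1M); last exact: reassoc_counit1.
rewrite /counit_leg1 [LHS]tsum3_pure; last by lin.
by rewrite counit1 scale1r.
Qed.
Lemma counit_leg2_inv : counit_leg2 Φ' = 1.
Proof.
apply: (counit_leg_inv counit_leg2M); last exact: reassoc_counit2.
rewrite /counit_leg2 [LHS]tsum3_pure; last by lin.
by rewrite counit1 scale1r.
Qed.
Lemma counit_leg3_inv : counit_leg3 Φ' = 1.
Proof.
apply: (counit_leg_inv counit_leg3M); last exact: reassoc_counit3.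
rewrite /counit_leg3 [LHS]tsum3_pure; last by lin.
by rewrite counit1 scale1r.
Qed.

Section Functional.
Variables (W : lmodType k) (F : H -> H -> W).
Hypothesis hF : bilin F.
Let ev t := \sw_(a, b <- t) F a b.
Let lev : linear ev. Proof. by rewrite /ev; lin. Qed.

(** The scalar and the two remaining legs are arbitrary functions of the three components, so that
    one computation serves each choice of the leg to which [ε] is applied. *)
Let ev_leg (t : H ⊗ H ⊗ H) (c : H -> H -> H -> k) (G G' : H -> H -> H -> H) :
  ev (\sw_(x, y, z <- t) c x y z *: (G x y z ⊗ G' x y z))
  = \sw_(x, y, z <- t) c x y z *: F (G x y z) (G' x y z).
Proof.
rewrite (linear_tsum t _ lev); apply: eq_tsum => s z.
rewrite (linear_tsum s _ lev); apply: eq_tsum => x y.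
by rewrite linear_scale // /ev tsum_pure.
Qed.

Let ev1 : ev (1 ⊗ 1) = F 1 1. Proof. by rewrite /ev tsum_pure. Qed.

Lemma sw_counit1 : \sw_(X1, X2, X3 <- Φ) ε X1 *: F X2 X3 = F 1 1.
Proof. by rewrite -ev1 -(reassoc_counit1 H) ev_leg. Qed.
Lemma sw_counit2 : \sw_(X1, X2, X3 <- Φ) ε X2 *: F X1 X3 = F 1 1.
Proof. by rewrite -ev1 -(reassoc_counit2 H) ev_leg. Qed.
Lemma sw_counit3 : \sw_(X1, X2, X3 <- Φ) ε X3 *: F X1 X2 = F 1 1.
Proof. by rewrite -ev1 -(reassoc_counit3 H) ev_leg. Qed.
Lemma sw_counit_inv1 : \sw_(x1, x2, x3 <- Φ') ε x1 *: F x2 x3 = F 1 1.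
Proof. by rewrite -ev1 -[(1 : H) ⊗ (1 : H)]counit_leg1_inv ev_leg. Qed.
Lemma sw_counit_inv2 : \sw_(x1, x2, x3 <- Φ') ε x2 *: F x1 x3 = F 1 1.
Proof. by rewrite -ev1 -[(1 : H) ⊗ (1 : H)]counit_leg2_inv ev_leg. Qed.
Lemma sw_counit_inv3 : \sw_(x1, x2, x3 <- Φ') ε x3 *: F x1 x2 = F 1 1.
Proof. by rewrite -ev1 -[(1 : H) ⊗ (1 : H)]counit_leg3_inv ev_leg. Qed.

End Functional.
End Counit.

(** * Contractions with the antipode *)

Lemma scaler_tsum (k : fieldType) (U V W : lmodType k) c (t : U ⊗ V)
    (F : U -> V -> W) :
  c *: tsum t F = \sw_(a, b <- t) c *: F a b.
Proof. by apply: (linear_tsum t F (f := fun w => c *: w)); lin. Qed.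

Lemma tsum_exch32 (k : fieldType) (U V X U' V' : lmodType k) (W : zmodType)
    (s : U ⊗ V ⊗ X) (t : U' ⊗ V') (F : U -> V -> X -> U' -> V' -> W) :
  \sw_(a, b, c <- s) \sw_(p, q <- t) F a b c p q
  = \sw_(p, q <- t) \sw_(a, b, c <- s) F a b c p q.
Proof.
rewrite -tsum_exch; apply: eq_tsum => r c; exact: tsum_exch.
Qed.

Lemma tsum_exch33 (k : fieldType) (U V X U' V' X' : lmodType k) (W : zmodType)
    (s : U ⊗ V ⊗ X) (t : U' ⊗ V' ⊗ X') (F : U -> V -> X -> U' -> V' -> X' -> W) :
  \sw_(a, b, c <- s) \sw_(p, q, r <- t) F a b c p q r
  = \sw_(p, q, r <- t) \sw_(a, b, c <- s) F a b c p q r.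
Proof.
rewrite tsum_exch32; apply: eq_tsum => u r; exact: tsum_exch32.
Qed.

Lemma eq_tsum3 (k : fieldType) (U V X : lmodType k) (W : zmodType)
    (t : U ⊗ V ⊗ X) (F G : U -> V -> X -> W) :
  (forall a b c, F a b c = G a b c) ->
  \sw_(a, b, c <- t) F a b c = \sw_(a, b, c <- t) G a b c.
Proof. by move=> FG; sw_ext. Qed.

Section Contractions.
Variables (k : fieldType) (H : quasiHopf k).
Local Notation Φ := (@reassoc k H).
Local Notation Φ' := (@reassoc_inv k H).
Local Notation ε := (@counit k H).
Local Notation S := (@antipode k H).
Local Notation α := (@alpha k H).
Local Notation β := (@beta k H).

Section Linear.
Variables (W : lmodType k) (f : H -> W).
Hypothesis lf : linear f.

Lemma sw_alpha (h : H) :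
  \sw_(h1, h2 <- comul h) f (S h1 * α * h2) = ε h *: f α.
Proof. by rewrite -(linear_scale lf) -antipode_alpha (linear_tsum _ _ lf). Qed.

Lemma sw_beta (h : H) :
  \sw_(h1, h2 <- comul h) f (h1 * β * S h2) = ε h *: f β.
Proof. by rewrite -(linear_scale lf) -antipode_beta (linear_tsum _ _ lf). Qed.

Lemma sw_antipode_assoc :
  \sw_(X1, X2, X3 <- Φ) f (X1 * β * S X2 * α * X3) = f 1.
Proof.
rewrite -(antipode_assoc H) (linear_tsum _ _ lf); apply: eq_tsum => s X3.
by rewrite (linear_tsum _ _ lf).
Qed.

Lemma sw_antipode_assoc_inv :
  \sw_(x1, x2, x3 <- Φ') f (S x1 * α * x2 * β * S x3) = f 1.
Proof.
rewrite -(antipode_assoc_inv H) (linear_tsum _ _ lf); apply: eq_tsum => s x3.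
by rewrite (linear_tsum _ _ lf).
Qed.

End Linear.

Section Bilinear.
Variables (W : lmodType k) (F : H -> H -> W).
Hypothesis hF : bilin F.

(** A cap contracts two neighbouring legs by $S(\cdot)\alpha\,\cdot$, a cup by $\cdot\,\beta
    S(\cdot)$. Quasi-coassociativity moves [h] to the left of [Φ], where its components in the
    contracted legs meet [α] and leave only a counit. *)
Lemma sw_cap (h : H) :
  \sw_(X1, X2, X3 <- Φ) \sw_(h1, h2 <- comul h) \sw_(h11, h12 <- comul h1)
     F (X1 * h11) (S (X2 * h12) * α * (X3 * h2))
  = \sw_(X1, X2, X3 <- Φ) F (h * X1) (S X2 * α * X3).
Proof.
rewrite (sw_coassoc (F := fun a b c => F a (S b * α * c))); last by lin.
apply: eq_tsum3 => X1 X2 X3.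
rewrite -(sw_counitr (f := fun a => F (a * X1) (S X2 * α * X3))); last by lin.
apply: eq_tsum => h1 h2.
rewrite -(sw_alpha (f := fun c => F (h1 * X1) (S X2 * c * X3))); last by lin.
by apply: eq_tsum => h21 h22; rewrite antipodeM !mulrA.
Qed.

(** Now [α] joins the first two legs, and [h] crosses [Φ'] from right to left. *)
Lemma sw_cap_inv (h : H) :
  \sw_(x1, x2, x3 <- Φ') \sw_(h1, h2 <- comul h) \sw_(h21, h22 <- comul h2)
     F (S (x1 * h1) * α * (x2 * h21)) (x3 * h22)
  = \sw_(x1, x2, x3 <- Φ') F (S x1 * α * x2) (h * x3).
Proof.
rewrite (sw_coassoc_inv (F := fun a b c => F (S a * α * b) c)); last by lin.
apply: eq_tsum3 => x1 x2 x3.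
rewrite -(sw_counitl (f := fun a => F (S x1 * α * x2) (a * x3))); last by lin.
apply: eq_tsum => h1 h2.
rewrite -(sw_alpha (f := fun c => F (S x1 * c * x2) (h2 * x3))); last by lin.
by apply: eq_tsum => h21 h22; rewrite antipodeM !mulrA.
Qed.

(** Quasi-coassociativity puts [h] on the right of [Φ'], where its last two components surround [β]
    and contract to a counit. *)
Lemma sw_cup_inv (h : H) :
  \sw_(x1, x2, x3 <- Φ') \sw_(h1, h2 <- comul h) \sw_(h11, h12 <- comul h1)
     F (h11 * x1) (h12 * x2 * β * S (h2 * x3))
  = \sw_(x1, x2, x3 <- Φ') F (x1 * h) (x2 * β * S x3).
Proof.
rewrite -(sw_coassoc_inv (F := fun a b c => F a (b * β * S c))); last by lin.
apply: eq_tsum3 => x1 x2 x3.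
rewrite -(sw_counitr (f := fun a => F (x1 * a) (x2 * β * S x3))); last by lin.
apply: eq_tsum => h1 h2.
rewrite -(sw_beta (f := fun c => F (x1 * h1) (x2 * c * S x3))); last by lin.
by apply: eq_tsum => h21 h22; rewrite antipodeM !mulrA.
Qed.

End Bilinear.

(** After [sw_pentagon1] the components of $\Delta(X^2)$ surround [α] and contract to
    $\varepsilon(X^2)$; the counit axiom for the middle leg then removes this copy of [Φ]. *)
Lemma sw_pentagon1_cap (W : lmodType k) (F : H -> H -> H -> W) :
  trilin F ->
  \sw_(x1, x2, x3 <- Φ') \sw_(X1, X2, X3 <- Φ) \sw_(X31, X32 <- comul X3)
     F X1 (S (x1 * X2) * α * (x2 * X31)) (x3 * X32)
  = \sw_(Y1, Y2, Y3 <- Φ) \sw_(z1, z2, z3 <- Φ') \sw_(z11, z12 <- comul z1)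
     F (Y1 * z11) (S (Y2 * z12) * α * (Y3 * z2)) z3.
Proof.
move=> hF.
rewrite (sw_pentagon1 (F := fun a b c d => F a (S b * α * c) d)); last by lin.
(* [G] is what remains after the contraction, as a function of the two outer legs of the copy of [Φ]
   to be removed. *)
pose G a c := \sw_(Y1, Y2, Y3 <- Φ) \sw_(z1, z2, z3 <- Φ')
  \sw_(z11, z12 <- comul z1)
  F (a * Y1 * z11) (S (Y2 * z12) * α * (Y3 * z2)) (c * z3).
transitivity (\sw_(X1, X2, X3 <- Φ) ε X2 *: G X1 X3); last first.
  rewrite sw_counit2; last by rewrite /G; lin.
  by rewrite /G; sw_ext; rewrite !mul1r.
apply: eq_tsum3 => X1 X2 X3; rewrite /G.
rewrite scaler_tsum; apply: eq_tsum => s Y3.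
rewrite scaler_tsum; apply: eq_tsum => Y1 Y2.
rewrite scaler_tsum; apply: eq_tsum => s' z3.
rewrite scaler_tsum; apply: eq_tsum => z1 z2.
rewrite tsum_exch scaler_tsum; apply: eq_tsum => z11 z12.
rewrite -(sw_alpha (f := fun c => F (X1 * Y1 * z11) (S (Y2 * z12) * c *
  (Y3 * z2)) (X3 * z3))); last by lin.
by sw_ext; rewrite !antipodeM !mulrA.
Qed.

Section Bilinear2.
Variables (W : lmodType k) (F : H -> H -> W).
Hypothesis hF : bilin F.

(** Joining the first two legs of [sw_pentagon1_cap] by [β] contracts $\Delta(z^1)$ to a counit,
    which removes $\Phi^{-1}$; the rest is $Y^1\beta S(Y^2)\alpha Y^3=1$. This makes [β] a left unit
    of [H0]. *)
Lemma sw_pentagon1_cup :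
  \sw_(x1, x2, x3 <- Φ') \sw_(X1, X2, X3 <- Φ) \sw_(X31, X32 <- comul X3)
     F (X1 * β * (S (x1 * X2) * α * (x2 * X31))) (x3 * X32) = F 1 1.
Proof.
rewrite (sw_pentagon1_cap (F := fun a b c => F (a * β * b) c)); last by lin.
rewrite -(sw_antipode_assoc (f := fun a => F a 1)); last by lin.
apply: eq_tsum3 => Y1 Y2 Y3.
transitivity (\sw_(z1, z2, z3 <- Φ')
  ε z1 *: F (Y1 * β * S Y2 * α * Y3 * z2) z3); last first.
  rewrite (sw_counit_inv1 (F := fun a b => F (Y1 * β * S Y2 * α * Y3 * a) b)).
    by rewrite mulr1.
  by lin.
apply: eq_tsum3 => z1 z2 z3.
rewrite -(sw_beta (f := fun c => F (Y1 * c * S Y2 * α * Y3 * z2) z3));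
  last by lin.
by sw_ext; rewrite !antipodeM !mulrA.
Qed.

(** Read backwards, [sw_pentagon1_cap] with [β] joining the last two legs contracts $\Delta(X^3)$ to
    a counit; the rest is $S(x^1)\alpha x^2\beta S(x^3)=1$. *)
Lemma sw_pentagon1_zigzag :
  \sw_(Z1, Z2, Z3 <- Φ) \sw_(y1, y2, y3 <- Φ') \sw_(y11, y12 <- comul y1)
     F (Z1 * y11) (S (Z2 * y12) * α * (Z3 * y2) * β * S y3) = F 1 1.
Proof.
rewrite -(sw_pentagon1_cap (F := fun a b c => F a (b * β * S c))); last by lin.
rewrite -(sw_antipode_assoc_inv (f := fun a => F 1 a)); last by lin.
apply: eq_tsum3 => x1 x2 x3.
transitivity (\sw_(X1, X2, X3 <- Φ)
  ε X3 *: F X1 (S (x1 * X2) * α * x2 * β * S x3)); last first.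
  rewrite (sw_counit3 (F := fun a b => F a (S (x1 * b) * α * x2 * β * S x3))).
    by rewrite mulr1.
  by lin.
apply: eq_tsum3 => X1 X2 X3.
rewrite -(sw_beta (f := fun c => F X1 (S (x1 * X2) * α * x2 * c * S x3)));
  last by lin.
by sw_ext; rewrite !antipodeM !mulrA.
Qed.

(** After [sw_pentagon2], [α] contracts $\Delta(x^3)$ and [β] contracts $\Delta(Z^2)$. Between them
    $Y^1\beta S(Y^2)\alpha Y^3=1$ appears, and the two counits remove the other associators. *)
Lemma sw_pentagon2_zigzag :
  \sw_(X1, X2, X3 <- Φ) \sw_(x1, x2, x3 <- Φ') \sw_(X11, X12 <- comul X1)
     F (X11 * x1) (X12 * x2 * β * S (X2 * x3) * α * X3) = F 1 1.
Proof.
rewrite (sw_pentagon2 (F := fun a b c d => F a (b * β * S c * α * d)));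
  last by lin.
have <- : \sw_(x1, x2, x3 <- Φ') ε x3 *: F x1 x2 = F 1 1.
  exact: sw_counit_inv3.
apply: eq_tsum3 => x1 x2 x3; rewrite tsum_exch33.
have <- : \sw_(Z1, Z2, Z3 <- Φ) ε Z2 *: F (x1 * Z1) (x2 * Z3) = F x1 x2.
  rewrite (sw_counit2 (F := fun a b => F (x1 * a) (x2 * b))); last by lin.
  by rewrite !mulr1.
rewrite scaler_tsum; apply: eq_tsum => s Z3.
rewrite scaler_tsum; apply: eq_tsum => Z1 Z2.
(* The inserted unit is the one to be expanded as $Y^1\beta S(Y^2)\alpha Y^3$. *)
have -> : F (x1 * Z1) (x2 * Z3) = F (x1 * Z1) (x2 * 1 * Z3) by rewrite mulr1.
rewrite -(sw_antipode_assoc (f := fun a =>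
  ε x3 *: (ε Z2 *: F (x1 * Z1) (x2 * a * Z3)))); last by lin.
apply: eq_tsum3 => Y1 Y2 Y3.
rewrite -(sw_alpha (f := fun c => ε Z2 *: F (x1 * Z1)
  (x2 * (Y1 * β * S Y2 * c * Y3) * Z3))); last by lin.
apply: eq_tsum => x31 x32.
rewrite -(sw_beta (f := fun c => F (x1 * Z1)
  (x2 * (Y1 * c * S Y2 * (S x31 * α * x32) * Y3) * Z3))); last by lin.
by sw_ext; rewrite !antipodeM !mulrA.
Qed.

End Bilinear2.

(** As for [sw_pentagon1_cap]: [α] joins the first two legs, contracts $\Delta(X^1)$ and thereby
    removes [Φ]. *)
Lemma sw_pentagon3_cap (W : lmodType k) (F : H -> H -> H -> W) :
  trilin F ->
  \sw_(x1, x2, x3 <- Φ') \sw_(Y1, Y2, Y3 <- Φ) \sw_(x31, x32 <- comul x3)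
     F (S x1 * α * (x2 * Y1)) (x31 * Y2) (x32 * Y3)
  = \sw_(y1, y2, y3 <- Φ') \sw_(z1, z2, z3 <- Φ') \sw_(z21, z22 <- comul z2)
     F (S (y1 * z1) * α * (y2 * z21)) (y3 * z22) z3.
Proof.
move=> hF.
rewrite (sw_pentagon3 (F := fun a b c d => F (S a * α * b) c d)); last by lin.
pose G a b := \sw_(y1, y2, y3 <- Φ') \sw_(z1, z2, z3 <- Φ')
  \sw_(z21, z22 <- comul z2)
  F (S (y1 * z1) * α * (y2 * z21)) (a * y3 * z22) (b * z3).
transitivity (\sw_(X1, X2, X3 <- Φ) ε X1 *: G X2 X3); last first.
  rewrite sw_counit1; last by rewrite /G; lin.
  by rewrite /G; sw_ext; rewrite !mul1r.
apply: eq_tsum3 => X1 X2 X3; rewrite /G.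
rewrite scaler_tsum; apply: eq_tsum => s y3.
rewrite scaler_tsum; apply: eq_tsum => y1 y2.
rewrite scaler_tsum; apply: eq_tsum => s' z3.
rewrite scaler_tsum; apply: eq_tsum => z1 z2.
rewrite tsum_exch scaler_tsum; apply: eq_tsum => z21 z22.
rewrite -(sw_alpha (f := fun c => F (S (y1 * z1) * c * (y2 * z21))
  (X2 * y3 * z22) (X3 * z3))); last by lin.
by sw_ext; rewrite !antipodeM !mulrA.
Qed.
End Contractions.

(** * The Drinfeld twist *)

Section Twist.
Variables (k : fieldType) (H : quasiHopf k).
Local Notation Φ := (@reassoc k H).
Local Notation Φ' := (@reassoc_inv k H).
Local Notation ε := (@counit k H).
Local Notation S := (@antipode k H).
Local Notation α := (@alpha k H).
Local Notation β := (@beta k H).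

Lemma sw_twist_delta (W : lmodType k) (f : H ⊗ H -> W) :
  linear f ->
  f (twist_delta H)
  = \sw_(X1, X2, X3 <- Φ) \sw_(y1, y2, y3 <- Φ') \sw_(X11, X12 <- comul X1)
     f ((X11 * y1 * β * S X3) ⊗ (X12 * y2 * β * S (X2 * y3))).
Proof.
move=> lf.
rewrite -(sw_comul_leg1_inv (F := fun a b c d =>
  f ((a * β * S d) ⊗ (b * β * S c)))); last by lin.
rewrite /twist_delta /eval4 -[\sw_(a, b, c <- Φ) _]/(comul_leg1 Φ).
rewrite (linear_tsum _ _ lf); apply: eq_tsum => r d.
rewrite (linear_tsum _ _ lf); apply: eq_tsum => s c.
by rewrite (linear_tsum _ _ lf).
Qed.

Section Bilinear.
Variables (W : lmodType k) (F : H -> H -> W).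
Hypothesis hF : bilin F.

(** $\Delta(S(x^1)\alpha x^2)$ absorbs the $\Delta(C^1)$ of [twist_delta], and since [S] reverses
    products the right-hand factor merges into $S(x^3_2C^3)$ and $S(x^3_1C^2y^3)$. *)
Lemma sw_twist_inv :
  \sw_(g1, g2 <- @drinfeld_twist_inv k H) F g1 g2
  = \sw_(x1, x2, x3 <- Φ') \sw_(C1, C2, C3 <- Φ) \sw_(x31, x32 <- comul x3)
    \sw_(y1, y2, y3 <- Φ') \sw_(e1, e2 <- comul (S x1 * α * (x2 * C1)))
     F (e1 * y1 * β * S (x32 * C3)) (e2 * y2 * β * S (x31 * C2 * y3)).
Proof.
pose ev t := \sw_(a, b <- t) F a b.
have lev : linear ev by rewrite /ev; lin.
rewrite -[LHS]/(ev _) (linear_tsum _ _ lev); apply: eq_tsum => s x3.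
rewrite (linear_tsum s _ lev); apply: eq_tsum => x1 x2.
rewrite (sw_twist_delta (f := fun t => ev (_ * t * _))); last by lin.
apply: eq_tsum3 => C1 C2 C3.
rewrite -[RHS]tsum_exch32; apply: eq_tsum3 => y1 y2 y3.
pose G a b := \sw_(x31, x32 <- comul x3)
  F (a * y1 * β * S (x32 * C3)) (b * y2 * β * S (x31 * C2 * y3)).
transitivity (\sw_(e1, e2 <- comul (S x1 * α * x2 * C1)) G e1 e2); last first.
  by rewrite /G tsum_exch -!mulrA.
rewrite sw_comulM; last by rewrite /G; lin.
rewrite [RHS]tsum_exch; apply: eq_tsum => C11 C12.
rewrite (linear_expand (f := fun t => ev (t * _ * _))); last by lin.
apply: eq_tsum => a1 a2.
rewrite /antipode_cop (tsum_mull (comul x3)) (linear_tsum (comul x3) _ lev).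
apply: eq_tsum => x31 x32.
rewrite !tensor2_mul_pure /ev tsum_pure //.
by rewrite !antipodeM !mulrA.
Qed.

(** The inner associator [y] of the twist cancels against the outer [Z]: first [sw_cap] pulls [e]
    out to the left, then [sw_pentagon1_zigzag] applies. *)
Lemma sw_zigzag (c d e : H) :
  \sw_(y1, y2, y3 <- Φ') \sw_(e1, e2 <- comul e) \sw_(Z1, Z2, Z3 <- Φ)
  \sw_(p1, p2 <- comul (e1 * (y1 * d)))
     F (Z1 * p1) (S (Z2 * p2) * α * (Z3 * (e2 * y2 * β * S (c * y3))))
  = \sw_(d1, d2 <- comul d) F (e * d1) (S (c * d2)).
Proof.
transitivity (\sw_(y1, y2, y3 <- Φ') \sw_(r1, r2 <- comul (y1 * d))
    \sw_(Z1, Z2, Z3 <- Φ)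
    F (e * Z1 * r1) (S r2 * (S Z2 * α * Z3) * y2 * β * S (c * y3))).
  apply: eq_tsum3 => y1 y2 y3; rewrite -tsum_exch32.
  transitivity (\sw_(Z1, Z2, Z3 <- Φ) \sw_(e1, e2 <- comul e)
    \sw_(e11, e12 <- comul e1) \sw_(r1, r2 <- comul (y1 * d))
    F (Z1 * e11 * r1)
      (S r2 * (S (Z2 * e12) * α * (Z3 * e2)) * y2 * β * S (c * y3))).
    apply: eq_tsum3 => Z1 Z2 Z3; apply: eq_tsum => e1 e2.
    rewrite sw_comulM; last by lin.
    by sw_ext; rewrite !antipodeM !mulrA.
  rewrite (sw_cap (F := fun a b => \sw_(r1, r2 <- comul (y1 * d))
     F (a * r1) (S r2 * b * y2 * β * S (c * y3)))); last by lin.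
  by rewrite tsum_exch32.
(* $\Delta(y^1d)$ is split so that all components of [y] stand next to those of [Z]. *)
transitivity (\sw_(d1, d2 <- comul d)
    \sw_(Z1, Z2, Z3 <- Φ) \sw_(y1, y2, y3 <- Φ') \sw_(y11, y12 <- comul y1)
    F (e * (Z1 * y11) * d1)
      (S d2 * (S (Z2 * y12) * α * (Z3 * y2) * β * S y3) * S c)).
  transitivity (\sw_(y1, y2, y3 <- Φ') \sw_(d1, d2 <- comul d)
    \sw_(Z1, Z2, Z3 <- Φ) \sw_(y11, y12 <- comul y1)
    F (e * (Z1 * y11) * d1)
      (S d2 * (S (Z2 * y12) * α * (Z3 * y2) * β * S y3) * S c)); last first.
    by rewrite tsum_exch32; apply: eq_tsum => d1 d2; rewrite tsum_exch33.
  apply: eq_tsum3 => y1 y2 y3.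
  rewrite sw_comulM; last by lin.
  rewrite tsum_exch; apply: eq_tsum => d1 d2.
  rewrite tsum_exch32; apply: eq_tsum => y11 y12.
  by sw_ext; rewrite !antipodeM !mulrA.
apply: eq_tsum => d1 d2.
rewrite (sw_pentagon1_zigzag (F := fun a b => F (e * a * d1) (S d2 * b * S c))).
  by rewrite !mulr1 antipodeM.
by lin.
Qed.

End Bilinear.

Section Bilinear2.
Variables (W : lmodType k) (F : H -> H -> W).
Hypothesis hF : bilin F.

(** With [sw_twist_inv] unfolded, this is [sw_zigzag] for $e=S(x^1)\alpha x^2C^1$, $c=x^3_1C^2$ and
    $d=\beta S(x^3_2C^3)m$. *)
Lemma sw_cap_twist_inv (m : H) :
  \sw_(g1, g2 <- @drinfeld_twist_inv k H) \sw_(Z1, Z2, Z3 <- Φ)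
  \sw_(p1, p2 <- comul (g1 * m)) F (Z1 * p1) (S (Z2 * p2) * α * (Z3 * g2))
  = \sw_(x1, x2, x3 <- Φ') \sw_(C1, C2, C3 <- Φ) \sw_(x31, x32 <- comul x3)
    \sw_(d1, d2 <- comul (β * S (x32 * C3) * m))
     F (S x1 * α * (x2 * C1) * d1) (S (x31 * C2 * d2)).
Proof.
rewrite (sw_twist_inv (F := fun g1 g2 => \sw_(Z1, Z2, Z3 <- Φ)
  \sw_(p1, p2 <- comul (g1 * m)) F (Z1 * p1) (S (Z2 * p2) * α * (Z3 * g2))));
  last by lin.
apply: eq_tsum3 => x1 x2 x3; apply: eq_tsum3 => C1 C2 C3.
apply: eq_tsum => x31 x32; rewrite -(sw_zigzag hF).
apply: eq_tsum3 => y1 y2 y3; apply: eq_tsum => e1 e2.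
by apply: eq_tsum3 => Z1 Z2 Z3; rewrite !mulrA.
Qed.

(** [sw_cup_inv] carries [w] across [z] to the far right of the first leg; what is left is
    [sw_pentagon2_zigzag]. *)
Lemma sw_cup_pentagon2 (w : H) :
  \sw_(z1, z2, z3 <- Φ') \sw_(X1, X2, X3 <- Φ) \sw_(w1, w2 <- comul w)
  \sw_(h1, h2 <- comul (X1 * w1))
     F (h1 * z1) (h2 * (z2 * (β * S (X2 * w2 * z3) * α * X3)))
  = F w 1.
Proof.
transitivity (F (1 * w) 1); last by rewrite mul1r.
rewrite -(sw_pentagon2_zigzag (F := fun a b => F (a * w) b)); last by lin.
rewrite tsum_exch33; apply: eq_tsum3 => X1 X2 X3.
transitivity (\sw_(X11, X12 <- comul X1) \sw_(z1, z2, z3 <- Φ')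
  \sw_(w1, w2 <- comul w) \sw_(w11, w12 <- comul w1)
  F (X11 * (w11 * z1))
    (X12 * (w12 * z2 * β * S (w2 * z3)) * S X2 * α * X3)).
  rewrite -tsum_exch32; apply: eq_tsum3 => z1 z2 z3.
  rewrite [RHS]tsum_exch; apply: eq_tsum => w1 w2.
  rewrite sw_comulM; last by lin.
  by sw_ext; rewrite !antipodeM !mulrA.
rewrite [RHS]tsum_exch32; apply: eq_tsum => X11 X12.
rewrite (sw_cup_inv (F := fun a b => F (X11 * a) (X12 * b * S X2 * α * X3))).
  by sw_ext; rewrite !antipodeM !mulrA.
by lin.
Qed.

End Bilinear2.

(** The factor $X^1\otimes S(X^2)\alpha X^3$ comes from $q_R$; its first leg has to be brought next
    to the other two before it can be cancelled. *)
Lemma sw_cap_twist_qR (W : lmodType k) (F : H -> H -> W) (w : H) :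
  bilin F ->
  \sw_(x1, x2, x3 <- Φ') \sw_(C1, C2, C3 <- Φ) \sw_(x31, x32 <- comul x3)
  \sw_(X1, X2, X3 <- Φ) \sw_(w1, w2 <- comul w)
  \sw_(d1, d2 <- comul (β * S (X2 * w2 * (x32 * C3)) * α * X3))
     F (S x1 * α * (x2 * C1) * d1) (X1 * w1 * (x31 * C2) * d2)
  = \sw_(y1, y2, y3 <- Φ') F (S (y1 * w) * α * y2) y3.
Proof.
move=> hF.
rewrite (sw_pentagon3_cap (F := fun a b c => \sw_(X1, X2, X3 <- Φ)
  \sw_(w1, w2 <- comul w) \sw_(d1, d2 <- comul (β * S (X2 * w2 * c) * α * X3))
  F (a * d1) (X1 * w1 * b * d2))); last by lin.
(* After [sw_pentagon3_cap], the two components of $z^2$ are absorbed into the coproduct that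
   follows them. *)
transitivity (\sw_(z1, z2, z3 <- Φ') \sw_(X1, X2, X3 <- Φ)
  \sw_(w1, w2 <- comul w)
  \sw_(s1, s2 <- comul (z2 * (β * S (X2 * w2 * z3) * α * X3)))
  \sw_(y1, y2, y3 <- Φ')
  F (S z1 * (S y1 * α * y2) * s1) (X1 * w1 * y3 * s2)).
  rewrite tsum_exch33; apply: eq_tsum3 => z1 z2 z3.
  transitivity (\sw_(y1, y2, y3 <- Φ') \sw_(X1, X2, X3 <- Φ)
    \sw_(w1, w2 <- comul w)
    \sw_(s1, s2 <- comul (z2 * (β * S (X2 * w2 * z3) * α * X3)))
    F (S z1 * (S y1 * α * y2) * s1) (X1 * w1 * y3 * s2)).
    apply: eq_tsum3 => y1 y2 y3.
    rewrite -tsum_exch32; apply: eq_tsum3 => X1 X2 X3.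
    rewrite tsum_exch; apply: eq_tsum => w1 w2.
    rewrite sw_comulM; last by lin.
    by sw_ext; rewrite !antipodeM !mulrA.
  rewrite tsum_exch33; apply: eq_tsum3 => X1 X2 X3.
  rewrite tsum_exch32; apply: eq_tsum => w1 w2.
  by rewrite tsum_exch32.
(* [sw_cap_inv], read backwards, carries $X^1w_1$ through [y] to the right, where it meets [z] as
   [sw_cup_pentagon2] requires. *)
transitivity (\sw_(y1, y2, y3 <- Φ') \sw_(z1, z2, z3 <- Φ')
  \sw_(X1, X2, X3 <- Φ) \sw_(w1, w2 <- comul w)
  \sw_(h1, h2 <- comul (X1 * w1))
  \sw_(t1, t2 <- comul (h2 * (z2 * (β * S (X2 * w2 * z3) * α * X3))))
  F (S (y1 * (h1 * z1)) * α * y2 * t1) (y3 * t2)).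
  rewrite [RHS]tsum_exch33; apply: eq_tsum3 => z1 z2 z3.
  rewrite [RHS]tsum_exch33; apply: eq_tsum3 => X1 X2 X3.
  rewrite [RHS]tsum_exch32; apply: eq_tsum => w1 w2.
  set s := (z2 * _).
  transitivity (\sw_(s1, s2 <- comul s) \sw_(y1, y2, y3 <- Φ')
    \sw_(h1, h2 <- comul (X1 * w1)) \sw_(h21, h22 <- comul h2)
    F (S z1 * (S (y1 * h1) * α * (y2 * h21)) * s1) (y3 * h22 * s2)).
    apply: eq_tsum => s1 s2.
    by rewrite (sw_cap_inv (F := fun a b => F (S z1 * a * s1) (b * s2))) //;
      lin.
  rewrite -tsum_exch32; apply: eq_tsum3 => y1 y2 y3.
  rewrite tsum_exch; apply: eq_tsum => h1 h2.
  rewrite tsum_exch sw_comulM; last by lin.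
  by sw_ext; rewrite !antipodeM !mulrA.
apply: eq_tsum3 => y1 y2 y3.
rewrite (sw_cup_pentagon2 (F := fun a b => \sw_(t1, t2 <- comul b)
  F (S (y1 * a) * α * y2 * t1) (y3 * t2))); last by lin.
by rewrite sw_comul1 ?mulr1 //; lin.
Qed.
End Twist.

(** * Compatibility with the twisting map *)

Section Compatibility.
Variables (k : fieldType) (H : quasiHopf k).
Local Notation Φ := (@reassoc k H).
Local Notation Φ' := (@reassoc_inv k H).
Local Notation ε := (@counit k H).
Local Notation S := (@antipode k H).
Local Notation α := (@alpha k H).
Local Notation β := (@beta k H).

(** * The module algebra $B^v$ *)

Section AlgMul.
Variables (B : assocAlgType k) (v : H -> B).
Hypothesis hv : algebra_map v.
Let vlin : linear v. Proof. by case: hv. Qed.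
Let vM : {morph v : x y / x * y}. Proof. by case: hv. Qed.

Lemma alg_act_bilin : bilin (alg_act v).
Proof. by rewrite /alg_act; lin. Qed.

Lemma alg_mul_bilin : bilin (alg_mul v).
Proof. by rewrite /alg_mul; lin. Qed.

(** [sw_pentagon1_cap] puts $z^1_1$ and $S(z^1_2)$ on the two sides of [b], which is the action of
    $z^1$. *)
Lemma alg_mulE b c :
  alg_mul v b c
  = \sw_(Y1, Y2, Y3 <- Φ) \sw_(z1, z2, z3 <- Φ')
      v Y1 * alg_act v z1 b * v (S Y2 * α * (Y3 * z2)) * c * v (S z3).
Proof.
transitivity (\sw_(x1, x2, x3 <- Φ') \sw_(X1, X2, X3 <- Φ)
  \sw_(X31, X32 <- comul X3)
  v X1 * b * v (S (x1 * X2) * α * (x2 * X31)) * c * v (S (x3 * X32))).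
  by rewrite tsum_exch33 /alg_mul; sw_ext; rewrite !mulrA.
rewrite (sw_pentagon1_cap (F := fun x y z => v x * b * v y * c * v (S z)));
  last by lin.
apply: eq_tsum3 => Y1 Y2 Y3; apply: eq_tsum3 => z1 z2 z3.
rewrite (linear_tsum (f := fun b => v Y1 * b * v (S Y2 * α * (Y3 * z2)) * c
  * v (S z3))); last by lin.
by sw_ext; rewrite !antipodeM !vM !mulrA.
Qed.

(** The operations of [H0] and of $B^v$ are given by the same formulas, so [v] passes through each
    Sweedler sum. *)
Lemma alg_map_morphism : @module_algebra_morphism k H (H0 H) (alg_ma v) v.
Proof.
split=> //= [h a|a b].
  by rewrite /alg_act (linear_tsum _ _ vlin); sw_ext; rewrite !vM.
rewrite /alg_mul (linear_tsum _ _ vlin); apply: eq_tsum => s X3.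
do 4!(rewrite (linear_tsum _ _ vlin); apply: eq_tsum => ? ?).
by rewrite !vM.
Qed.

End AlgMul.

(** [sw_cap] frees [e] from the contraction, after which [sw_cap_twist_inv] eliminates the twist. *)
Lemma sw_cap_conj (W : lmodType k) (F : H -> H -> W) (e m t : H) :
  bilin F ->
  \sw_(e1, e2 <- comul e) \sw_(g1, g2 <- @drinfeld_twist_inv k H)
  \sw_(Z1, Z2, Z3 <- Φ) \sw_(p1, p2 <- comul (e1 * (g1 * m)))
    F (Z1 * p1) (S (Z2 * p2) * α * (Z3 * (e2 * g2)) * S t)
  = \sw_(x1, x2, x3 <- Φ') \sw_(C1, C2, C3 <- Φ) \sw_(x31, x32 <- comul x3)
    \sw_(d1, d2 <- comul (β * S (x32 * C3) * m))
     F (e * (S x1 * α * (x2 * C1) * d1)) (S (x31 * C2 * d2) * S t).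
Proof.
move=> hF.
rewrite -(sw_cap_twist_inv (F := fun a b => F (e * a) (b * S t)));
  last by lin.
rewrite tsum_exch; apply: eq_tsum => g1 g2.
transitivity (\sw_(Z1, Z2, Z3 <- Φ) \sw_(e1, e2 <- comul e)
  \sw_(e11, e12 <- comul e1) \sw_(p1, p2 <- comul (g1 * m))
  F (Z1 * e11 * p1) (S p2 * (S (Z2 * e12) * α * (Z3 * e2)) * g2 * S t)).
  rewrite -tsum_exch32; apply: eq_tsum3 => Z1 Z2 Z3; apply: eq_tsum => e1 e2.
  rewrite sw_comulM; last by lin.
  by sw_ext; rewrite !antipodeM !mulrA.
rewrite (sw_cap (F := fun a b => \sw_(p1, p2 <- comul (g1 * m))
  F (a * p1) (S p2 * b * g2 * S t))); last by lin.
by sw_ext; rewrite !antipodeM !mulrA.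
Qed.

(** Applying [S] to the second leg cancels the inverse antipode in $q_R$. *)
Lemma sw_qR (W : lmodType k) (F : H -> H -> W) :
  bilin F ->
  \sw_(q1, q2 <- @qR k H) F q1 (S q2)
  = \sw_(X1, X2, X3 <- Φ) F X1 (S X2 * α * X3).
Proof.
move=> hF.
have lF : linear (fun t => \sw_(q1, q2 <- t) F q1 (S q2)) by lin.
rewrite (linear_tsum _ _ lF); apply: eq_tsum => s X3.
rewrite (linear_tsum _ _ lF); apply: eq_tsum => X1 X2.
by rewrite tsum_pure ?antipodeM ?antipode_invK ?mulrA //; lin.
Qed.

(** * The product of $B^v$ after the twisting map *)

Section Input.
Variables (A : moduleAlgebra H) (B : assocAlgType k) (v : H -> B) (u : A -> B).
Hypothesis hv : algebra_map v.
Hypothesis ulin : linear u.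
Hypothesis uact : forall h a, u (h ▷ a) = alg_act v h (u a).
Let vlin : linear v. Proof. by case: hv. Qed.
Let vM : {morph v : x y / x * y}. Proof. by case: hv. Qed.
Let act_lin : bilin (@ma_act k H A). Proof. exact: ma_act_bilinear. Qed.

(** [alg_mulE] makes $z^1$ act on $u(X^1t_1\cdot a)$, so [H]-linearity of [u] brings [z] next to [X]
    in all three legs and $\Phi^{-1}\Phi=1$ cancels both. *)
Lemma alg_mul_reassoc (a : A) (t1 t2 t3 : H) :
  \sw_(X1, X2, X3 <- Φ)
    alg_mul v (u (X1 * t1 ▷ a)) (v (X2 * t2 * S (X3 * t3)))
  = \sw_(Z1, Z2, Z3 <- Φ) \sw_(p1, p2 <- comul t1)
    v (Z1 * p1) * u a * v (S (Z2 * p2) * α * (Z3 * t2) * S t3).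
Proof.
transitivity (\sw_(z1, z2, z3 <- Φ') \sw_(X1, X2, X3 <- Φ)
  \sw_(Z1, Z2, Z3 <- Φ) v Z1 * u (z1 * X1 * t1 ▷ a)
    * v (S Z2 * α * (Z3 * (z2 * X2 * t2 * S (z3 * X3 * t3))))).
  rewrite tsum_exch33; apply: eq_tsum3 => X1 X2 X3.
  rewrite (alg_mulE hv) tsum_exch33; apply: eq_tsum3 => z1 z2 z3.
  apply: eq_tsum3 => Z1 Z2 Z3.
  by rewrite -uact -ma_actM !antipodeM !vM !mulrA.
rewrite (sw_reassoc_invl (F := fun b c d => \sw_(Z1, Z2, Z3 <- Φ)
  v Z1 * u (b * t1 ▷ a) * v (S Z2 * α * (Z3 * (c * t2 * S (d * t3))))));
  last by lin.
apply: eq_tsum3 => Z1 Z2 Z3.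
rewrite !mul1r uact.
rewrite (linear_tsum (f := fun b => v Z1 * b * v (S Z2 * α * (Z3 * (t2 * S t3)))));
  last by lin.
by sw_ext; rewrite !antipodeM !vM !mulrA.
Qed.

Lemma R_diamond_pure (h : H) (a : A) :
  R_diamond ((h : H0 H) ⊗ a)
  = \sw_(X1, X2, X3 <- Φ) \sw_(Y1, Y2, Y3 <- Φ)
  \sw_(Y11, Y12 <- comul Y1) \sw_(Y21, Y22 <- comul Y2)
  \sw_(h1, h2 <- comul h)
  \sw_(g1, g2 <- @drinfeld_twist_inv k H) \sw_(q1, q2 <- @qR k H)
    (X1 * Y11 * h1 * g1 * S (q2 * Y22) * Y3 ▷ a)
    ⊗ (X2 * Y12 * h2 * g2 * S (X3 * q1 * Y21) : H0 H).
Proof. by rewrite /R_diamond tsum_pure //; lin. Qed.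

Lemma R_diamond_linear : linear (@R_diamond k H A).
Proof. by rewrite /R_diamond; lin. Qed.

Lemma R_diamond_compat (h : H) (a : A) :
  \sw_(b, d <- R_diamond ((h : H0 H) ⊗ a)) alg_mul v (u b) (v d)
  = alg_mul v (v h) (u a).
Proof.
have hM := alg_mul_bilin v.
pose ev (t : A ⊗ H0 H) := \sw_(b, d <- t) alg_mul v (u b) (v d).
have lev : linear ev by rewrite /ev; lin.
have evp b (d : H) : ev (b ⊗ (d : H0 H)) = alg_mul v (u b) (v d).
  by rewrite /ev tsum_pure //; lin.
pose G x y := v x * u a * v y.
have hG : bilin G by rewrite /G; lin.
(* First stage: [alg_mul_reassoc] removes the outer associator of [R], and $Y^1_1h_1\otimes
   Y^1_2h_2$ is collected into $\Delta(Y^1h)$. *)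
transitivity (\sw_(Y1, Y2, Y3 <- Φ) \sw_(Y21, Y22 <- comul Y2)
  \sw_(q1, q2 <- @qR k H)
  \sw_(e1, e2 <- comul (Y1 * h)) \sw_(g1, g2 <- @drinfeld_twist_inv k H)
  \sw_(Z1, Z2, Z3 <- Φ) \sw_(p1, p2 <- comul (e1 * (g1 * (S (q2 * Y22) * Y3))))
  G (Z1 * p1) (S (Z2 * p2) * α * (Z3 * (e2 * g2)) * S (q1 * Y21))).
  rewrite -[LHS]/(ev _) R_diamond_pure.
  transitivity (\sw_(Y1, Y2, Y3 <- Φ)
    \sw_(Y11, Y12 <- comul Y1) \sw_(Y21, Y22 <- comul Y2)
    \sw_(h1, h2 <- comul h)
    \sw_(g1, g2 <- @drinfeld_twist_inv k H) \sw_(q1, q2 <- @qR k H)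
    \sw_(X1, X2, X3 <- Φ)
    alg_mul v (u (X1 * (Y11 * h1 * (g1 * (S (q2 * Y22) * Y3))) ▷ a))
      (v (X2 * (Y12 * h2 * g2) * S (X3 * (q1 * Y21))))).
    rewrite (linear_tsum _ _ lev).
    transitivity (\sw_(X1, X2, X3 <- Φ) \sw_(Y1, Y2, Y3 <- Φ)
      \sw_(Y11, Y12 <- comul Y1) \sw_(Y21, Y22 <- comul Y2)
      \sw_(h1, h2 <- comul h)
      \sw_(g1, g2 <- @drinfeld_twist_inv k H) \sw_(q1, q2 <- @qR k H)
      alg_mul v (u (X1 * (Y11 * h1 * (g1 * (S (q2 * Y22) * Y3))) ▷ a))
        (v (X2 * (Y12 * h2 * g2) * S (X3 * (q1 * Y21))))).
      apply: eq_tsum => s X3.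
      do 8!(rewrite (linear_tsum _ _ lev); apply: eq_tsum => ? ?).
      by rewrite evp !mulrA.
    rewrite tsum_exch33; apply: eq_tsum3 => Y1 Y2 Y3.
    by do 5!(rewrite tsum_exch32; apply: eq_tsum => ? ?).
  apply: eq_tsum3 => Y1 Y2 Y3.
  rewrite tsum_exch; apply: eq_tsum => Y21 Y22.
  transitivity (\sw_(Y11, Y12 <- comul Y1) \sw_(h1, h2 <- comul h)
    \sw_(q1, q2 <- @qR k H) \sw_(g1, g2 <- @drinfeld_twist_inv k H)
    \sw_(Z1, Z2, Z3 <- Φ)
    \sw_(p1, p2 <- comul (Y11 * h1 * (g1 * (S (q2 * Y22) * Y3))))
    G (Z1 * p1) (S (Z2 * p2) * α * (Z3 * (Y12 * h2 * g2)) * S (q1 * Y21))).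
    apply: eq_tsum => Y11 Y12; apply: eq_tsum => h1 h2.
    rewrite tsum_exch; apply: eq_tsum => q1 q2; apply: eq_tsum => g1 g2.
    exact: alg_mul_reassoc.
  transitivity (\sw_(q1, q2 <- @qR k H)
    \sw_(Y11, Y12 <- comul Y1) \sw_(h1, h2 <- comul h)
    \sw_(g1, g2 <- @drinfeld_twist_inv k H)
    \sw_(Z1, Z2, Z3 <- Φ)
    \sw_(p1, p2 <- comul (Y11 * h1 * (g1 * (S (q2 * Y22) * Y3))))
    G (Z1 * p1) (S (Z2 * p2) * α * (Z3 * (Y12 * h2 * g2)) * S (q1 * Y21))).
    rewrite [RHS]tsum_exch; apply: eq_tsum => Y11 Y12.
    by rewrite tsum_exch.
  by apply: eq_tsum => q1 q2; rewrite sw_comulM //; lin.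
(* Second stage: [sw_cap_conj] with $e=Y^1h$ removes the twist, [sw_qR] replaces $q_R$ by a copy [X]
   of [Φ], and $\Delta(Y^3)$ is split off. *)
transitivity (\sw_(Y1, Y2, Y3 <- Φ)
  \sw_(x1, x2, x3 <- Φ') \sw_(C1, C2, C3 <- Φ) \sw_(x31, x32 <- comul x3)
  \sw_(X1, X2, X3 <- Φ) \sw_(Y21, Y22 <- comul Y2)
  \sw_(d1, d2 <- comul (β * S (X2 * Y22 * (x32 * C3)) * α * X3))
  \sw_(Y31, Y32 <- comul Y3)
  G (Y1 * h * (S x1 * α * (x2 * C1) * d1 * Y31))
    (S (X1 * Y21 * (x31 * C2) * d2 * Y32))).
  apply: eq_tsum3 => Y1 Y2 Y3.
  transitivity (\sw_(Y21, Y22 <- comul Y2) \sw_(q1, q2 <- @qR k H)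
    \sw_(x1, x2, x3 <- Φ') \sw_(C1, C2, C3 <- Φ) \sw_(x31, x32 <- comul x3)
    \sw_(d1, d2 <- comul (β * S (x32 * C3) * (S Y22 * S q2 * Y3)))
    G (Y1 * h * (S x1 * α * (x2 * C1) * d1)) (S (q1 * Y21 * (x31 * C2 * d2)))).
    apply: eq_tsum => Y21 Y22; apply: eq_tsum => q1 q2.
    rewrite (sw_cap_conj _ _ _ hG) (antipodeM q2 Y22).
    by sw_ext; rewrite !antipodeM !mulrA.
  transitivity (\sw_(Y21, Y22 <- comul Y2) \sw_(X1, X2, X3 <- Φ)
    \sw_(x1, x2, x3 <- Φ') \sw_(C1, C2, C3 <- Φ) \sw_(x31, x32 <- comul x3)
    \sw_(d1, d2 <- comul (β * S (X2 * Y22 * (x32 * C3)) * α * X3))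
    \sw_(Y31, Y32 <- comul Y3)
    G (Y1 * h * (S x1 * α * (x2 * C1) * d1 * Y31))
      (S (X1 * Y21 * (x31 * C2) * d2 * Y32))).
    apply: eq_tsum => Y21 Y22.
    rewrite (sw_qR (F := fun q1 q2 => \sw_(x1, x2, x3 <- Φ')
      \sw_(C1, C2, C3 <- Φ) \sw_(x31, x32 <- comul x3)
      \sw_(d1, d2 <- comul (β * S (x32 * C3) * (S Y22 * q2 * Y3)))
      G (Y1 * h * (S x1 * α * (x2 * C1) * d1))
        (S (q1 * Y21 * (x31 * C2 * d2))))); last by lin.
    apply: eq_tsum3 => X1 X2 X3; apply: eq_tsum3 => x1 x2 x3.
    apply: eq_tsum3 => C1 C2 C3; apply: eq_tsum => x31 x32.
    have -> : β * S (x32 * C3) * (S Y22 * (S X2 * α * X3) * Y3)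
            = β * S (X2 * Y22 * (x32 * C3)) * α * X3 * Y3.
      by rewrite !antipodeM !mulrA.
    rewrite sw_comulM; last by lin.
    by sw_ext; rewrite !mulrA.
  (* From here on only the order of summation changes: the sums over $\Delta(Y^2)$ and [X] move
     inside. *)
  etransitivity; first by apply: eq_tsum => ? ?; exact: tsum_exch33.
  rewrite -tsum_exch32; apply: eq_tsum3 => x1 x2 x3.
  etransitivity; first by apply: eq_tsum => ? ?; exact: tsum_exch33.
  rewrite -tsum_exch32; apply: eq_tsum3 => C1 C2 C3.
  etransitivity; first by apply: eq_tsum => ? ?; exact: tsum_exch32.
  rewrite tsum_exch; apply: eq_tsum => x31 x32.
  by rewrite -tsum_exch32.
(* Last stage: [sw_cap_twist_qR] with $w=Y^2$ leaves the defining formula of the product of [v h]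
   and [u a] in $B^v$. *)
transitivity (\sw_(Y1, Y2, Y3 <- Φ) \sw_(y1, y2, y3 <- Φ')
  \sw_(Y31, Y32 <- comul Y3)
  G (Y1 * h * (S (y1 * Y2) * α * y2 * Y31)) (S (y3 * Y32))).
  apply: eq_tsum3 => Y1 Y2 Y3.
  rewrite -(sw_cap_twist_qR (F := fun a b => \sw_(Y31, Y32 <- comul Y3)
    G (Y1 * h * (a * Y31)) (S (b * Y32)))) //; last by lin.
by rewrite /G /alg_mul; sw_ext; rewrite !vM !mulrA.
Qed.

End Input.
End Compatibility.

(** * Comparison of the two universal maps *)

Section Twisted.
Variables (k : fieldType) (H : quasiBialgebra k).
Local Notation Φ := (@reassoc k H).
Local Notation Φ' := (@reassoc_inv k H).
Local Notation ε := (@counit k H).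

Variables (A : moduleAlgebra H) (D : modAlgOps H) (R : D ⊗ A -> A ⊗ D).
Hypotheses (Dact : bilin (@ma_act k H D)) (Dmul : bilin (@ma_mul k H D)).
Hypothesis Rlin : linear R.
Let Aact : bilin (@ma_act k H A). Proof. exact: ma_act_bilinear. Qed.
Let Amul : bilin (@ma_mul k H A). Proof. exact: ma_mul_bilinear. Qed.

Lemma twisted_mul_pure (a a' : A) (d d' : D) :
  twisted_mul R (a ⊗ d) (a' ⊗ d')
  = \sw_(y1, y2, y3 <- Φ') \sw_(X1, X2, X3 <- Φ)
  \sw_(x1, x2, x3 <- Φ') \sw_(Y1, Y2, Y3 <- Φ)
  \sw_(X31, X32 <- comul X3) \sw_(y31, y32 <- comul y3)
  \sw_(r, r' <- R ((x1 * X2 ▷ d) ⊗ (x2 * X31 ▷ a')))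
    ((y1 * X1 ▷ a) ⋆ (y2 * Y1 ▷ r))
    ⊗ ((y31 * Y2 ▷ r') ⋆ (y32 * Y3 * x3 * X32 ▷ d')).
Proof. by rewrite /twisted_mul tsum_pure ?tsum_pure //; lin. Qed.

Hypothesis act_one : forall h, h ▷ ma_one D = ε h *: ma_one D.
Hypothesis act1 : forall d : D, 1 ▷ d = d.
Hypothesis mul1 : left_id (ma_one D) ma_mul.
Hypothesis R1 : R (ma_one D ⊗ ma_one A) = ma_one A ⊗ ma_one D.

(** Every factor acting on a unit becomes a counit, so all associators collapse. The proof runs
    backwards: units in $(1\cdot a)\otimes(1\cdot d)$ are expanded by counit identities until the
    formula for the product is reached. *)
Lemma twisted_mul_split (a : A) (d : D) :
  twisted_mul R (a ⊗ ma_one D) (ma_one A ⊗ d) = a ⊗ d.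
Proof.
rewrite twisted_mul_pure -{2}(ma_act1 a) -{2}(act1 d).
rewrite -(sw_counit_inv2 (F := fun y z => (y ▷ a) ⊗ (z ▷ d))); last by lin.
apply: eq_tsum3 => y1 y2 y3; rewrite -{2}(mulr1 y1) -{2}(mulr1 y3).
rewrite -(sw_counit2 (F := fun y z =>
  ε y2 *: ((y1 * y ▷ a) ⊗ (y3 * z ▷ d)))); last by lin.
apply: eq_tsum3 => X1 X2 X3.
(* An associator with two legs under counits is expanded from $\varepsilon(1)=1$: this scalar is the
   slot that receives the second such leg. *)
transitivity (ε X2 *: (ε y2 *: (ε 1 *: ((y1 * X1 ▷ a) ⊗ (y3 * (1 * X3) ▷ d)))));
  last by rewrite counit1 scale1r mul1r.
rewrite -(sw_counit_inv1 (F := fun y z => ε X2 *: (ε y2 *: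
  (ε y *: ((y1 * X1 ▷ a) ⊗ (y3 * (z * X3) ▷ d)))))); last by lin.
apply: eq_tsum3 => x1 x2 x3.
transitivity (ε x1 *: (ε X2 *: (ε y2 *: (ε x2 *: (ε 1 *:
  ((y1 * X1 ▷ a) ⊗ (y3 * 1 * (x3 * X3) ▷ d)))))));
  last by rewrite counit1 scale1r mulr1.
rewrite -(sw_counit1 (F := fun y z => ε x1 *: (ε X2 *: (ε y2 *: (ε x2 *: (ε y *:
  ((y1 * X1 ▷ a) ⊗ (y3 * z * (x3 * X3) ▷ d)))))))); last by lin.
apply: eq_tsum3 => Y1 Y2 Y3.
rewrite -(sw_counitl (f := fun z => ε Y1 *: (ε x1 *: (ε X2 *: (ε y2 *:
  (ε x2 *: (ε Y2 *: ((y1 * X1 ▷ a) ⊗ (y3 * Y3 * (x3 * z) ▷ d)))))))));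
  last by lin.
apply: eq_tsum => X31 X32.
rewrite -(sw_counitl (f := fun z => ε X31 *: (ε Y1 *: (ε x1 *: (ε X2 *: (ε y2 *:
  (ε x2 *: (ε Y2 *: ((y1 * X1 ▷ a) ⊗ (z * Y3 * (x3 * X32) ▷ d))))))))));
  last by lin.
apply: eq_tsum => y31 y32.
pose f t := \sw_(r, r' <- t) ((y1 * X1 ▷ a) ⋆ (y2 * Y1 ▷ r))
    ⊗ ((y31 * Y2 ▷ r') ⋆ (y32 * Y3 * x3 * X32 ▷ d)).
have lf : linear f by rewrite /f; lin.
rewrite -[LHS]/(f _) act_one ma_act_one pure_tensorZl pure_tensorZr scalerA.
rewrite (linear_scale Rlin) R1 (linear_scale lf) /f tsum_pure; last by lin.
rewrite ma_act_one act_one (linear_scale (Amul.2 _)) ma_mulr1.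
rewrite (linear_scale (Dmul.1 _)) mul1 pure_tensorZl pure_tensorZr !scalerA.
by rewrite !counitM !mulrA; congr (_ *: _); ring.
Qed.

End Twisted.

Section Extension.
Variables (k : fieldType) (H : quasiHopf k).
Local Notation Φ := (@reassoc k H).
Local Notation Φ' := (@reassoc_inv k H).
Local Notation ε := (@counit k H).
Local Notation S := (@antipode k H).
Local Notation α := (@alpha k H).
Local Notation β := (@beta k H).

Lemma H0_act_one (h : H) : h ▷ ma_one (H0 H) = ε h *: ma_one (H0 H).
Proof. exact: antipode_beta. Qed.

Lemma H0_act1 (h : H0 H) : 1 ▷ h = h.
Proof.
by rewrite /= /alg_act sw_comul1 ?antipode1 ?mulr1 ?mul1r //=; lin.
Qed.

(** The unit [β] stands between $X^1$ and the cap, exactly as in [sw_pentagon1_cup]. *)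
Lemma H0_mul1 : left_id (ma_one (H0 H)) ma_mul.
Proof.
move=> h /=; transitivity (1 * h * S 1); last by rewrite antipode1 mulr1 mul1r.
rewrite -(sw_pentagon1_cup (F := fun a b => a * h * S b)); last by lin.
by rewrite tsum_exch33 /alg_mul /=; sw_ext; rewrite !mulrA.
Qed.

(** Since $\varepsilon\circ S=\varepsilon$, the second leg may be put under [S], where [sw_qR]
    disposes of the inverse antipode. *)
Lemma sw_qR_counit (W : lmodType k) (f : H -> W) :
  linear f -> \sw_(q1, q2 <- @qR k H) ε q2 *: f q1 = f 1.
Proof.
move=> lf.
have -> : \sw_(q1, q2 <- @qR k H) ε q2 *: f q1
        = \sw_(q1, q2 <- @qR k H) ε (S q2) *: f q1.
  by sw_ext; rewrite counit_antipode.
rewrite (sw_qR (F := fun q1 q2 => ε q2 *: f q1)); last by lin.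
transitivity (ε 1 *: f 1); last by rewrite counit1 scale1r.
rewrite -(sw_counit3 (F := fun x y => ε y *: f x)); last by lin.
apply: eq_tsum3 => X1 X2 X3.
by rewrite scalerA !counitM counit_antipode counit_alpha mulr1 mulrC.
Qed.

(** A counit on the first leg collapses every coproduct and associator except the outermost, leaving
    $S(x^1)\alpha x^2\beta S(x^3)=1$. *)
Lemma sw_twist_inv_counit (W : lmodType k) (f : H -> W) :
  linear f -> \sw_(g1, g2 <- @drinfeld_twist_inv k H) ε g1 *: f g2 = f 1.
Proof.
move=> lf.
rewrite (sw_twist_inv (F := fun a b => ε a *: f b)); last by lin.
rewrite -(sw_antipode_assoc_inv lf).
apply: eq_tsum3 => x1 x2 x3.
transitivity (f (S x1 * α * (x2 * 1) * β * S (x3 * 1))); last by rewrite !mulr1.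
rewrite -(sw_counit3 (F := fun c d => f (S x1 * α * (x2 * c) * β * S (x3 * d))));
  last by lin.
apply: eq_tsum3 => C1 C2 C3.
rewrite -(sw_counitr (f := fun z => ε C3 *:
  f (S x1 * α * (x2 * C1) * β * S (z * C2)))); last by lin.
apply: eq_tsum => x31 x32.
transitivity (ε x32 *: (ε C3 *:
  f (S x1 * α * (x2 * C1) * 1 * β * S (x31 * C2 * 1)))); last by rewrite !mulr1.
rewrite -(sw_counit_inv1 (F := fun c d => ε x32 *: (ε C3 *:
  f (S x1 * α * (x2 * C1) * c * β * S (x31 * C2 * d))))); last by lin.
apply: eq_tsum3 => y1 y2 y3.
rewrite -(sw_counitl (f := fun z => ε y1 *: (ε x32 *: (ε C3 *:
  f (z * y2 * β * S (x31 * C2 * y3)))))); last by lin.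
apply: eq_tsum => e1 e2; rewrite !scalerA; congr (_ *: _).
by rewrite !counitM counit_beta counit_antipode counitM; ring.
Qed.

Section Smash.
Variable A : moduleAlgebra H.
Let Aact : bilin (@ma_act k H A). Proof. exact: ma_act_bilinear. Qed.
Let Amul : bilin (@ma_mul k H A). Proof. exact: ma_mul_bilinear. Qed.

(** All that acts on the unit of [A] turns into counits, which collapse both associators, the twist
    and $q_R$; as in [twisted_mul_split] they are inserted backwards, starting from $1\,h\,S(1)$. *)
Lemma R_diamond_one (h : H) :
  R_diamond ((h : H0 H) ⊗ ma_one A) = ma_one A ⊗ (h : H0 H).
Proof.
pose t (x : H) : A ⊗ H0 H := ma_one A ⊗ (x : H0 H).
have lt : linear t by rewrite /t; lin.
rewrite R_diamond_pure -[RHS]/(t h).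
transitivity (t (1 * h * S 1)); last by rewrite antipode1 mulr1 mul1r.
rewrite -(sw_counit1 (F := fun x y => t (x * h * S y))); last by lin.
apply: eq_tsum3 => X1 X2 X3.
transitivity (ε X1 *: t (X2 * 1 * h * S (X3 * 1))); last by rewrite !mulr1.
rewrite -(sw_counit3 (F := fun x y => ε X1 *: t (X2 * x * h * S (X3 * y))));
  last by lin.
apply: eq_tsum3 => Y1 Y2 Y3.
rewrite -(sw_counitl (f := fun z => ε Y3 *: (ε X1 *:
  t (X2 * z * h * S (X3 * Y2))))); last by lin.
apply: eq_tsum => Y11 Y12.
rewrite -(sw_counitr (f := fun z => ε Y11 *: (ε Y3 *: (ε X1 *:
  t (X2 * Y12 * h * S (X3 * z)))))); last by lin.
apply: eq_tsum => Y21 Y22.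
rewrite -(sw_counitl (f := fun z => ε Y22 *: (ε Y11 *: (ε Y3 *: (ε X1 *:
  t (X2 * Y12 * z * S (X3 * Y21))))))); last by lin.
apply: eq_tsum => h1 h2.
transitivity (ε h1 *: (ε Y22 *: (ε Y11 *: (ε Y3 *: (ε X1 *:
  t (X2 * Y12 * h2 * 1 * S (X3 * 1 * Y21))))))); last by rewrite !mulr1.
rewrite -(sw_twist_inv_counit (f := fun z => ε h1 *: (ε Y22 *: (ε Y11 *:
  (ε Y3 *: (ε X1 *: t (X2 * Y12 * h2 * z * S (X3 * 1 * Y21))))))));
  last by lin.
apply: eq_tsum => g1 g2.
rewrite -(sw_qR_counit (f := fun z => ε g1 *: (ε h1 *: (ε Y22 *: (ε Y11 *:
  (ε Y3 *: (ε X1 *: t (X2 * Y12 * h2 * g2 * S (X3 * z * Y21)))))))));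
  last by lin.
apply: eq_tsum => q1 q2.
rewrite ma_act_one pure_tensorZl !scalerA; congr (_ *: _).
by rewrite !counitM counit_antipode counitM; ring.
Qed.

Lemma diamond_split (a : A) (h : H) :
  ma_mul (m := diamond A) (a ⊗ ma_one (H0 H)) (ma_one A ⊗ (h : H0 H))
  = a ⊗ (h : H0 H).
Proof.
apply: twisted_mul_split.
- exact: alg_act_bilin.
- exact: alg_mul_bilin.
- exact: R_diamond_linear.
- exact: H0_act_one.
- exact: H0_act1.
- exact: H0_mul1.
- exact: R_diamond_one.
Qed.

(** * The smash product and the comparison map *)

Lemma smash_mul_pure (a a' : A) (h h' : H) :
  smash_mul (a ⊗ h) (a' ⊗ h')
  = \sw_(x1, x2, x3 <- Φ') \sw_(h1, h2 <- comul h)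
    ((x1 ▷ a) ⋆ (x2 * h1 ▷ a')) ⊗ (x3 * h2 * h').
Proof. by rewrite /smash_mul tsum_pure ?tsum_pure //; lin. Qed.

Lemma smash_mul_bilin : bilin (@smash_mul k H A).
Proof. by rewrite /smash_mul; lin. Qed.

Lemma smash_mul_jl (a : A) (h h' : H) :
  smash_mul (smash_j A h) (a ⊗ h')
  = \sw_(h1, h2 <- comul h) (h1 ▷ a) ⊗ (h2 * h').
Proof.
rewrite smash_mul_pure.
transitivity (\sw_(h1, h2 <- comul h) (1 * h1 ▷ a) ⊗ (1 * h2 * h'));
  last by sw_ext; rewrite !mul1r.
rewrite -(sw_counit_inv1 (F := fun x y => \sw_(h1, h2 <- comul h)
  (x * h1 ▷ a) ⊗ (y * h2 * h'))); last by lin.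
apply: eq_tsum3 => x1 x2 x3; rewrite scaler_tsum; apply: eq_tsum => h1 h2.
by rewrite ma_act_one (linear_scale (Amul.1 _)) ma_mul1 pure_tensorZl.
Qed.

Lemma smash_mul_jr (a : A) (h h' : H) :
  smash_mul (a ⊗ h) (smash_j A h') = a ⊗ (h * h').
Proof.
rewrite smash_mul_pure.
transitivity ((1 ▷ a) ⊗ (1 * h * h')); last by rewrite ma_act1 mul1r.
rewrite -(sw_counit_inv2 (F := fun x y => (x ▷ a) ⊗ (y * h * h')));
  last by lin.
apply: eq_tsum3 => x1 x2 x3.
rewrite -(sw_counitl (f := fun z => ε x2 *: ((x1 ▷ a) ⊗ (x3 * z * h'))));
  last by lin.
apply: eq_tsum => h1 h2.
rewrite ma_act_one (linear_scale (Amul.2 _)) ma_mulr1 pure_tensorZl !scalerA.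
by rewrite counitM mulrC.
Qed.

(** The images of [smash_i0] and [smash_j] generate the smash product: multiplying out gives the
    element of [sw_pentagon2_zigzag]. Hence an extension is determined by [u] and [v]. *)
Lemma smash_decomp (a : A) (h : H) :
  \sw_(X1, X2, X3 <- Φ)
    smash_mul (smash_mul (smash_j A X1) (smash_i0 a))
              (smash_j A (S X2 * α * X3 * h))
  = a ⊗ h.
Proof.
have lM := smash_mul_bilin.
transitivity ((1 ▷ a) ⊗ (1 * h)); last by rewrite ma_act1 mul1r.
rewrite -(sw_pentagon2_zigzag (F := fun x y => (x ▷ a) ⊗ (y * h)));
  last by lin.
apply: eq_tsum3 => X1 X2 X3; rewrite /smash_i0.
pose f t := smash_mul (smash_mul (smash_j A X1) t)
              (smash_j A (S X2 * α * X3 * h)).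
have lf : linear f by rewrite /f; lin.
rewrite -[LHS]/(f _) (linear_tsum _ _ lf); apply: eq_tsum => s x3.
rewrite (linear_tsum _ _ lf); apply: eq_tsum => x1 x2.
rewrite /f smash_mul_jl.
rewrite (linear_tsum (f := fun t => smash_mul t _)); last by lin.
apply: eq_tsum => X11 X12.
by rewrite smash_mul_jr -ma_actM !antipodeM !mulrA.
Qed.

Variables (B : assocAlgType k) (v : H -> B) (u : A -> B).
Hypothesis hv : algebra_map v.
Hypothesis ulin : linear u.
Hypothesis uact : forall h a, u (h ▷ a) = alg_act v h (u a).
Let vlin : linear v. Proof. by case: hv. Qed.
Let vM : {morph v : x y / x * y}. Proof. by case: hv. Qed.

Lemma smash_extensionE (uv : A ⊗ H -> B) (a : A) (h : H) :
  smash_extension v u uv ->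
  uv (a ⊗ h) = \sw_(X1, X2, X3 <- Φ) v X1 * u a * v (S X2 * α * X3 * h).
Proof.
case=> -[uvlin uvM _] uvi uvj.
rewrite -(smash_decomp a h) (linear_tsum _ _ uvlin); apply: eq_tsum => s X3.
rewrite (linear_tsum _ _ uvlin); apply: eq_tsum => X1 X2.
by rewrite !uvM uvi !uvj.
Qed.

Lemma Pi_diamond_pure (a : A) (h : H) :
  Pi_diamond (a ⊗ (h : H0 H) : diamond A)
  = \sw_(x1, x2, x3 <- Φ') (x1 ▷ a) ⊗ (x2 * h * S x3).
Proof. by rewrite /Pi_diamond tsum_pure //; lin. Qed.

Lemma Pi_diamond_linear : linear (@Pi_diamond k H A : A ⊗ H0 H -> A ⊗ H).
Proof. by rewrite /Pi_diamond; lin. Qed.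

(** By [H]-linearity of [u], the formula of [smash_extensionE] on each summand of [Pi_diamond_pure]
    is a summand of [alg_mulE]. *)
Lemma smash_extension_Pi (uv : A ⊗ H -> B) (a : A) (h : H) :
  smash_extension v u uv ->
  uv (Pi_diamond (a ⊗ (h : H0 H) : diamond A)) = alg_mul v (u a) (v h).
Proof.
move=> huv; have [[uvlin _ _] _ _] := huv.
rewrite Pi_diamond_pure (alg_mulE hv) tsum_exch33.
rewrite (linear_tsum _ _ uvlin); apply: eq_tsum => s x3.
rewrite (linear_tsum _ _ uvlin); apply: eq_tsum => x1 x2.
rewrite (smash_extensionE _ _ huv); apply: eq_tsum3 => X1 X2 X3.
by rewrite uact -!mulrA -!vM !mulrA.
Qed.

End Smash.
End Extension.

Theorem proposition7p1 (k : fieldType) (H : quasiHopf k) (A : moduleAlgebra H)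
    (B : assocAlgType k) (v : H -> B) (hv : algebra_map v)
    (u : A -> alg_ma v) (hu : module_algebra_morphism u) :
  twisted_tensor_input (@R_diamond k H A) u (v : H0 H -> alg_ma v) /\
  (forall uv : tensor A H -> B,
     smash_extension v u uv ->
   forall w : diamond A -> alg_ma v,
     twisted_tensor_extension (R := @R_diamond k H A)
       u (v : H0 H -> alg_ma v) w ->
   forall t : diamond A, uv (Pi_diamond t) = w t).
Proof.
have [ulin uact _ _] := hu.
have ulin' : linear (u : A -> B) by exact: ulin.
have [vlin _ _] := hv.
have hM := alg_mul_bilin v.
split.
  split=> //; first exact: alg_map_morphism.
  (* The product of $B^v$ as a linear map on the tensor square, so that it can be pushed through the
     sum defining [tmap]. *)
  pose mult (t : B ⊗ B) : B := \sw_(b, c <- t) alg_mul v b c.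
  have lmult : linear mult by rewrite /mult; lin.
  have lR := @R_diamond_linear k H A.
  have E1 (t : A ⊗ H0 H) : ma_mult (tmap u (v : H0 H -> alg_ma v) t)
      = \sw_(b, d <- t) alg_mul v (u b) (v d).
    rewrite -[LHS]/(mult _) /tmap (linear_tsum _ _ lmult).
    by sw_ext; rewrite /mult tsum_pure.
  have E2 (t : H0 H ⊗ A) : ma_mult (tmap (v : H0 H -> alg_ma v) u t)
      = \sw_(d, b <- t) alg_mul v (v d) (u b).
    rewrite -[LHS]/(mult _) /tmap (linear_tsum _ _ lmult).
    by sw_ext; rewrite /mult tsum_pure.
  move=> t; rewrite E1 E2.
  move: t; apply: tensor_lin_ext => [||h a].
  - by lin.
  - by lin.
  rewrite [LHS](R_diamond_compat hv ulin' uact).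
  by rewrite tsum_pure //; lin.
move=> uv huv w [[wlin wact wM w1] wu wv].
have [[uvlin _ _] _ _] := huv.
apply: tensor_lin_ext => [|//|a h].
  exact: linear_comp uvlin (@Pi_diamond_linear k H A).
(* Multiplicativity of [w] applied to $a\otimes h=(a\otimes\beta)(1_A\otimes h)$ gives the same
   product of [u a] and [v h] in $B^v$. *)
by rewrite (smash_extension_Pi hv uact) // -diamond_split wM wu wv.
Qed.
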